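(* Let $\ell\ge 1$ and let $F$ be a graph with a color-critical edge such that $M_\ell$ does not contain $F$; let $k$ denote the chromatic number of $F$. Then there exists $n_0$ such that for every $n\ge n_0$, \[\mathrm{ex}(n,M_\ell,F)=\mathcal{N}(M_\ell,T_{k-1}(n)),\] i.e. $M_\ell$ is $F$-Tur\'an-good.
   Context: $M_\ell$ denotes the matching with $\ell$ edges ($2\ell$ vertices). For graphs $H,G$, $\mathcal{N}(H,G)$ is the number of subgraphs of $G$ isomorphic to $H$, and $\mathrm{ex}(n,H,F)$ is the maximum of $\mathcal{N}(H,G)$ over $F$-free graphs $G$ on $n$ vertices. $T_r(n)$ is the complete $r$-partite graph on $n$ vertices with all parts of size $\lfloor n/r\rfloor$ or $\lceil n/r\rceil$. An edge of $F$ is color-critical if deleting it decreases the chromatic number of $F$. For a $k$-chromatic $F$ and a graph $H$ not containing $F$, $H$ is $F$-Tur\'an-good if $\mathrm{ex}(n,H,F)=\mathcal{N}(H,T_{k-1}(n))$ for all $n$ large enough. *)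

(* Defs.v *)
(* Finite simple graphs are symmetric irreflexive relations on finTypes. *)
From mathcomp Require Import all_boot.
Set Implicit Arguments. Unset Strict Implicit. Unset Printing Implicit Defensive.

Section Graphs.

Definition edge_set (T : finType) (eG : rel T) : {set {set T}} :=
  [set [set x; y] | x in T, y in T & eG x y].

(* N(H,G): number of subgraphs (S, E) of G (S a vertex set, E a set of edges
   of G inside S) that are isomorphic to H. *)
Definition ncopies (W : finType) (eH : rel W) (T : finType) (eG : rel T) : nat :=
  #|[set p : {set T} * {set {set T}} |
      [&& p.2 \subset edge_set eG,
          [forall A in p.2, A \subset p.1] &
          [exists f : {ffun W -> T},
             [&& injectiveb f, f @: setT == p.1 &
                 [forall x, forall y, eH x y == ([set f x; f y] \in p.2)]]]]]|.

Definition contains (T : finType) (eG : rel T) (V : finType) (eF : rel V) : bool :=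
  [exists f : {ffun V -> T},
     injectiveb f && [forall x, forall y, eF x y ==> eG (f x) (f y)]].

Definition colorable (V : finType) (e : rel V) (k : nat) : bool :=
  [exists c : {ffun V -> 'I_k}, [forall x, forall y, e x y ==> (c x != c y)]].

Definition chi (V : finType) (e : rel V) : nat :=
  \big[minn/#|V|]_(k < #|V|.+1 | colorable e k) k.

Definition del_edge (V : finType) (e : rel V) (u v : V) : rel V :=
  fun x y => e x y && ~~ (((x == u) && (y == v)) || ((x == v) && (y == u))).

Definition has_color_critical_edge (V : finType) (e : rel V) : Prop :=
  exists u v, e u v /\ chi (del_edge e u v) < chi e.

Definition matching_rel (l : nat) : rel 'I_(l.*2) :=
  fun x y => (x != y) && ((val x)./2 == (val y)./2).

(* T_r(n): complete r-partite graph on n vertices, parts = residue classes mod r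
   (sizes floor(n/r) or ceil(n/r)) *)
Definition turan_rel (n r : nat) : rel 'I_n :=
  fun x y => (val x %% r) != (val y %% r).

Definition rel_of_set (n : nat) (E : {set 'I_n * 'I_n}) : rel 'I_n :=
  fun x y => (x, y) \in E.

Definition simple_set (n : nat) (E : {set 'I_n * 'I_n}) : bool :=
  [forall x, forall y, ((x, y) \in E) == ((y, x) \in E)] &&
  [forall x, (x, x) \notin E].

Definition ex_gen (n : nat) (W : finType) (eH : rel W) (V : finType) (eF : rel V) : nat :=
  \max_(E : {set 'I_n * 'I_n} | simple_set E && ~~ contains (rel_of_set E) eF)
     ncopies eH (rel_of_set E).

End Graphs.
Arguments matching_rel l : clear implicits.
Arguments turan_rel n r : clear implicits.

(* Main.v *)
(* Count ordered tuples of [l] disjoint oriented edges ([nmatch]); up to a constant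
   factor this is the number of copies of [M_l], and it satisfies a vertex-deletion
   recursion. Write [r] for the chromatic number minus one.

   Let [G] be [F]-free on [n] vertices. If some vertex has degree below the minimum
   degree of [T_r(n)], deleting it strictly decreases the excess of [nmatch G] over
   its value on the Turan graph: sharp product bounds for [l - 1] edges, which
   follow from the case [l = 1], show that the missing edge outweighs all error
   terms. Otherwise the minimum degree forces [G] to be [r]-partite, and among
   [r]-partite graphs the Turan graph is optimal because balancing two classes
   never decreases [nmatch]. As the excess is bounded on any fixed number of
   vertices, it vanishes for large [n] (progressive induction in the sense of
   Simonovits).

   For the [r]-partiteness, the minimum degree yields a complete [r]-partite
   subgraph with parts of constant size (Erdos-Stone); all but boundedly many
   vertices see exactly [r - 1] of its parts, and the color-critical edge forbids
   any edge inside the classes defined by the missed part. *)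
Require Import Defs.
From mathcomp Require Import all_boot zify.
Set Implicit Arguments. Unset Strict Implicit. Unset Printing Implicit Defensive.

(** * Counting matchings *)

Ltac bcase := repeat (match goal with
  | |- context [?x == ?y] => case: (x == y)
  | |- context [?x \in ?A] => case: (x \in A)
  | |- context [andb (?f ?x ?y) _] => case: (f x y)
  | |- context [andb _ (?f ?x ?y)] => case: (f x y)
  end => //=).

Definition edge_in (T : finType) (e : rel T) (U : {set T}) (p : T * T) : bool :=
  [&& p.1 \in U, p.2 \in U & e p.1 p.2].

(** The host set [U] is an argument so that deleting vertices never changes the vertex type. Each
    copy of [M_l] is counted 2^l l! times. *)
Fixpoint nmatch (T : finType) (e : rel T) (l : nat) (U : {set T}) : nat :=
  if l is l'.+1 then \sum_(p | edge_in e U p) nmatch e l' (U :\ p.1 :\ p.2) else 1.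

Arguments nmatch : simpl never.

Definition deg (T : finType) (e : rel T) (U : {set T}) (v : T) : nat :=
  #|[set y in U | e v y]|.

Section Count.
Variables (T : finType) (e : rel T).

Lemma nmatchS l (U : {set T}) :
  nmatch e l.+1 U = \sum_(p | edge_in e U p) nmatch e l (U :\ p.1 :\ p.2).
Proof. by []. Qed.

Hypotheses (e_sym : symmetric e) (e_irr : irreflexive e).

Lemma sum_fst_edges (U : {set T}) (v : T) (G : T * T -> nat) : v \in U ->
  \sum_(p | edge_in e U p && (p.1 == v)) G p = \sum_(y in U | e v y) G (v, y).
Proof.
move=> vU; rewrite (reindex_onto (fun y => (v, y)) snd) => [|[x y] /= /andP[_ /eqP->]//].
apply: eq_big => [y|//]; rewrite /edge_in /= vU eqxx !andbT /=; case: (y \in U) => //=.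
by rewrite eqxx andbT.
Qed.

Lemma sum_snd_edges (U : {set T}) (v : T) (G : T * T -> nat) : v \in U ->
  \sum_(p | edge_in e U p && (p.2 == v)) G p = \sum_(y in U | e v y) G (y, v).
Proof.
move=> vU; rewrite (reindex_onto (fun y => (y, v)) fst) => [|[x y] /= /andP[_ /eqP->]//].
by apply: eq_bigl => y; rewrite /edge_in /= vU !eqxx !andbT e_sym.
Qed.

Lemma edge_in_setD1 (U : {set T}) v p :
  edge_in e (U :\ v) p = [&& edge_in e U p, p.1 != v & p.2 != v].
Proof. by rewrite /edge_in !inE; bcase. Qed.

(** An oriented edge has [v] as its first endpoint, as its second, or not at all; irreflexivity
    excludes both at once. *)
Lemma sum_edges_vertex (U : {set T}) (v : T) (G : T * T -> nat) : v \in U ->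
  \sum_(p | edge_in e U p) G p =
  \sum_(y in U | e v y) (G (v, y) + G (y, v)) + \sum_(p | edge_in e (U :\ v) p) G p.
Proof.
move=> vU; have s1 := sum_fst_edges G vU; have s2 := sum_snd_edges G vU.
rewrite big_split /=; rewrite -[X in X + _ + _]s1 -[X in _ + X + _]s2.
rewrite (bigID (fun p => p.1 == v)) /= -addnA; congr (_ + _).
rewrite (bigID (fun p => p.2 == v)) /=; congr (_ + _); apply: eq_bigl => p.
  case: (p.2 =P v) => [p2|]; last by rewrite !andbF.
  rewrite !andbT; case: (p.1 =P v) => [p1|]; last by rewrite andbT.
  by rewrite andbF /edge_in p1 p2 e_irr !andbF.
by rewrite edge_in_setD1 andbA.
Qed.

(* Each tuple covering [v] has it in one of the [l.+1] edges, in one of the two positions. *)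
Lemma nmatch_vertex (l : nat) (U : {set T}) (v : T) : v \in U ->
  nmatch e l.+1 U = nmatch e l.+1 (U :\ v)
    + 2 * l.+1 * \sum_(y in U | e v y) nmatch e l (U :\ v :\ y).
Proof.
elim: l U v => [|l IH] U v vU.
  rewrite !nmatchS (sum_edges_vertex _ vU) addnC; congr (_ + _).
  by rewrite /nmatch muln1 big_distrr /=; apply: eq_bigr.
rewrite nmatchS (sum_edges_vertex _ vU) /=.
(* If the first edge [p] avoids [v], induction applies to [v] in [U] minus [p]; exchanging the sums
   over [p] and the partner [y] of [v] rebuilds counts on [U :\ v :\ y]. *)
have -> : \sum_(p | edge_in e (U :\ v) p) nmatch e l.+1 (U :\ p.1 :\ p.2) =
   nmatch e l.+2 (U :\ v) +
   2 * l.+1 * \sum_(y in U | e v y) nmatch e l.+1 (U :\ v :\ y).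
  pose S p := \sum_(y in U | [&& e v y, y != p.1 & y != p.2])
     nmatch e l (U :\ v :\ y :\ p.1 :\ p.2).
  rewrite (eq_bigr (fun p => nmatch e l.+1 (U :\ v :\ p.1 :\ p.2) + 2 * l.+1 * S p)).
    rewrite big_split /= -big_distrr /=; congr (_ + _ * _).
    rewrite /S (exchange_big_dep (fun y => (y \in U) && e v y)) /=; last first.
      by move=> p y _ /andP[-> /andP[->]].
    apply: eq_bigr => y /andP[yU vy]; apply: eq_bigl => p.
    rewrite [in RHS]edge_in_setD1 vy yU /=.
    by rewrite (eq_sym p.1) (eq_sym p.2).
  move=> p; rewrite edge_in_setD1 => /and3P[pU p1v p2v].
  have vUp : v \in U :\ p.1 :\ p.2 by rewrite !inE vU !(eq_sym v) p1v p2v.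
  rewrite [LHS](IH _ _ vUp); congr (_ + _ * _).
    by congr nmatch; apply/setP => z; rewrite !inE; bcase.
  apply: eq_big => [y|y _].
    by rewrite !inE; bcase.
  by congr nmatch; apply/setP => z; rewrite !inE; bcase.
have -> : \sum_(y in U | e v y) (nmatch e l.+1 (U :\ v :\ y) + nmatch e l.+1 (U :\ y :\ v)) =
    2 * \sum_(y in U | e v y) nmatch e l.+1 (U :\ v :\ y).
  rewrite big_distrr /=; apply: eq_bigr => y _.
  rewrite mul2n -addnn; congr (_ + nmatch e l.+1 _).
  by apply/setP => z; rewrite !inE; bcase.
lia.
Qed.

End Count.

Lemma nmatch_subrel (T : finType) (e e' : rel T) l (U : {set T}) :
  {in U &, subrel e e'} -> nmatch e l U <= nmatch e' l U.
Proof.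
elim: l U => [//|l IH] U sub; rewrite !nmatchS.
have subU p : edge_in e U p -> edge_in e' U p.
  by case/and3P=> p1 p2 ep; rewrite /edge_in p1 p2 sub.
rewrite [leqRHS](bigID (edge_in e U)) /=; apply: leq_trans (leq_addr _ _).
rewrite [leqRHS](eq_bigl (edge_in e U)) => [|p].
  apply: leq_sum => p _; apply: IH => x y.
  by rewrite !inE => /and3P[_ _ xU] /and3P[_ _ yU]; apply: sub.
by case: (boolP (edge_in e U p)) => [/subU->|]; rewrite ?andbF.
Qed.

(** Invariance under induced embeddings: it moves Turan graphs between ordinal types and coloured
    graphs into Turan graphs. *)
Lemma nmatch_imset (T T' : finType) (e : rel T) (e' : rel T') (f : T -> T') l (U : {set T}) :
  {in U &, injective f} -> {in U &, {mono f : x y / e x y >-> e' x y}} ->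
  nmatch e' l (f @: U) = nmatch e l U.
Proof.
elim: l U => [//|l IH] U f_inj f_mono; rewrite !nmatchS.
pose f2 (p : T * T) := (f p.1, f p.2).
have in_imset x : x \in U -> f x \in f @: U by move=> xU; apply: imset_f.
rewrite (eq_bigl (mem (f2 @: [set p | edge_in e U p]))) => [|[x' y']]; last first.
  apply/idP/imsetP => [/and3P[/= /imsetP[x xU ->] /imsetP[y yU ->]]|[[x y]]].
    by rewrite f_mono // => exy; exists (x, y); rewrite // inE /edge_in xU yU.
  rewrite inE => /and3P[/= xU yU exy] [-> ->].
  by rewrite /edge_in /= !in_imset // f_mono.
rewrite big_imset /= => [|[x y] [x1 y1]]; last first.
  rewrite !inE => /and3P[/= xU yU _] /and3P[/= x1U y1U _] [fx fy].
  by rewrite (f_inj _ _ xU x1U fx) (f_inj _ _ yU y1U fy).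
apply: eq_big => [p|[x y]]; first by rewrite inE.
rewrite inE => /and3P[/= xU yU _]; rewrite -IH; last 2 first.
- by move=> u v; rewrite !inE => /and3P[_ _ uU] /and3P[_ _ vU]; apply: f_inj.
- by move=> u v; rewrite !inE => /and3P[_ _ uU] /and3P[_ _ vU]; apply: f_mono.
congr nmatch; apply/setP => z; rewrite !inE; apply/and3P/imsetP.
  case=> zy zx /imsetP[u uU zu]; exists u => //; rewrite !inE uU andbT.
  by apply/andP; split; [apply: contraNneq zy | apply: contraNneq zx] => <-; rewrite zu.
case=> u; rewrite !inE => /and3P[uy ux uU] ->; split; last exact: in_imset.
  by apply: contra uy => /eqP /f_inj->.
by apply: contra ux => /eqP /f_inj->.
Qed.

(** The maximum [m] of [f] over [A] separates the sums: [f] is at most [m] on [A] and at least [m]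
    on [B]. *)
Lemma leq_sum_card (T : finType) (A B : {set T}) (f : T -> nat) : #|A| <= #|B| ->
  (forall a b, a \in A -> b \in B -> f a <= f b) ->
  \sum_(a in A) f a <= \sum_(b in B) f b.
Proof.
move=> cAB fAB; pose m := \max_(a in A) f a.
apply: (@leq_trans (#|A| * m)).
  by rewrite -sum_nat_const; apply: leq_sum => a aA; apply: leq_bigmax_cond.
apply: (@leq_trans (#|B| * m)); first by rewrite leq_mul2r cAB orbT.
rewrite -sum_nat_const; apply: leq_sum => b bB.
by apply/bigmax_leqP => a aA; apply: fAB.
Qed.

(** * Balancing the classes of complete multipartite graphs *)

Section Multipartite.
Variables (T : finType) (C : eqType) (c : T -> C).
Let e : rel T := fun x y => c x != c y.
Let e_sym : symmetric e. Proof. by move=> x y; rewrite /e eq_sym. Qed.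
Let e_irr : irreflexive e. Proof. by move=> x; rewrite /e eqxx. Qed.

(* By [nmatch_vertex] both sides are, up to a common term, sums of [nmatch] over
   the vertices outside one class, and these summands are ordered by induction. *)
Lemma nmatch_multipartite_setD1 l (X : {set T}) u w : u \in X -> w \in X ->
  #|[set y in X | c y == c u]| <= #|[set y in X | c y == c w]| ->
  nmatch e l (X :\ u) <= nmatch e l (X :\ w).
Proof.
elim: l X u w => [//|l IH] X u w uX wX.
have [->//|uw] := eqVneq u w.
move=> cuw; pose b := X :\ u :\ w.
have bE : X :\ w :\ u = b by apply/setP => z; rewrite !inE; bcase.
rewrite (@nmatch_vertex _ _ e_sym e_irr l (X :\ u) w) ?inE 1?eq_sym ?uw //.
rewrite (@nmatch_vertex _ _ e_sym e_irr l (X :\ w) u) ?inE ?uw // bE.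
rewrite leq_add2l leq_mul2l /=.
pose f y := nmatch e l (b :\ y).
rewrite (eq_bigl (fun y => (y \in b) && (c y != c w))); last first.
  by move=> y; rewrite !inE /e (eq_sym (c w)); case: (y =P w) => [->|_]; rewrite ?eqxx ?andbF.
rewrite [leqRHS](eq_bigl (fun y => (y \in b) && (c y != c u))); last first.
  move=> y; rewrite !inE /e (eq_sym (c u)).
  by case: (y =P u) => [->|_]; rewrite ?eqxx ?andbF.
have split_sum v : \sum_(y in b) f y =
    \sum_(y in [set y in b | c y == c v]) f y + \sum_(y in b | c y != c v) f y.
  rewrite (bigID (fun y => c y == c v)) /=; congr (_ + _).
  by apply: eq_bigl => y; rewrite [in RHS]inE.
(* The two sums omit from [b] the class of [w] and that of [u]; complementing in [b] leaves the sums
   over these classes to compare. *)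
suff : \sum_(y in [set y in b | c y == c u]) f y <= \sum_(y in [set y in b | c y == c w]) f y.
  by have := split_sum u; have := split_sum w; rewrite /f /b; lia.
have [cu_w|cu_w] := eqVneq (c u) (c w); first by rewrite cu_w.
have card_b v v' : v \in X -> v' \in X -> c v != c v' -> (X :\ v :\ v' == b) ->
    #|[set y in X | c y == c v]| = #|[set y in b | c y == c v]|.+1.
  move=> vX v'X cvv' /eqP bE'; rewrite (cardsD1 v) inE vX eqxx add1n -bE'; congr _.+1.
  apply: eq_card => y; rewrite !inE; have [->|_] := eqVneq y v'.
    by rewrite (eq_sym (c v')) (negPf cvv') !andbF.
  by bcase.
have cbuw : #|[set y in b | c y == c u]| <= #|[set y in b | c y == c w]|.
  by rewrite -ltnS -(card_b u w) // -(card_b w u) ?bE // eq_sym.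
apply: leq_sum_card => // y z; rewrite !inE => /andP[yb /eqP cy] /andP[zb /eqP cz].
by apply: IH; rewrite ?cy ?cz // !inE.
Qed.
End Multipartite.

(** Residues do not depend on the ambient size, so the first [n] vertices of any larger Turan graph
    induce [T_r(n)]. *)
Definition segment (M n : nat) : {set 'I_M} := [set x : 'I_M | x < n].

Definition turan_count (r l n : nat) : nat := nmatch (turan_rel n r) l setT.

Lemma nmatch_segment r l M n : n <= M ->
  nmatch (turan_rel M r) l (segment M n) = turan_count r l n.
Proof.
move=> nM; rewrite /turan_count.
rewrite -(@nmatch_imset _ _ (turan_rel n r) (turan_rel M r) (widen_ord nM) l setT).
- congr nmatch; apply/setP => x; rewrite inE; apply/idP/imsetP => [xn|[y _ ->]] /=.
    by exists (Ordinal xn) => //; apply: val_inj.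
  exact: ltn_ord.
- by move=> x y _ _ /(congr1 val) /= xy; apply: val_inj.
- by move=> x y.
Qed.

Lemma card_segment M n : n <= M -> #|segment M n| = n.
Proof.
move=> nM; rewrite -[RHS]card_ord -cardsT -(@card_imset _ _ (widen_ord nM)).
  apply: eq_card => x; rewrite inE; apply/idP/imsetP => [xn|[y _ ->]] /=.
    by exists (Ordinal xn) => //; apply: val_inj.
  exact: ltn_ord.
by move=> x y /(congr1 val) /= xy; apply: val_inj.
Qed.

(* The exchanged vertices are the least [w] outside [X] and some larger [u] in [X],
   congruent to [w] if possible; then the class of [u] is the larger one. *)
Lemma nmatch_turan_subset r l M (X : {set 'I_M}) : 0 < r ->
  nmatch (turan_rel M r) l X <= turan_count r l #|X|.
Proof.
(* The measure is the sum of the labels in [X]: exchanging [u] for the smaller [w] lowers it. *)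
move=> r0; have [s] := ubnP (\sum_(x in X) val x); elim: s X => // s IH X /ltnSE Xs.
have XM : #|X| <= M by rewrite -[leqRHS]card_ord max_card.
rewrite -(nmatch_segment _ _ XM).
have [/eqP<-//|XI] := boolP (X == segment M #|X|).
have [w0 w0X] : exists w, w \notin X.
  apply/existsP; apply: contraR XI => /existsPn XT.
  have XE : X = setT by apply/setP => x; rewrite inE; apply/negPn/XT.
  by rewrite XE cardsT card_ord; apply/eqP/setP => x; rewrite !inE ltn_ord.
case: (@arg_minnP _ w0 (fun w => w \notin X) (fun w : 'I_M => val w) w0X) => w /= wX w_min.
have belowX (y : 'I_M) : y < w -> y \in X.
  by move=> yw; apply: contraLR yw => /w_min; rewrite -leqNgt.
have [u1 /andP[u1X wu1]] : exists u, (u \in X) && (w < u).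
  apply/existsP; apply: contraR XI => /existsPn Xw.
  have XE : X = segment M w.
    apply/setP => x; rewrite inE; apply/idP/idP => [xX|/belowX//].
    have := Xw x; rewrite xX /= -leqNgt leq_eqVlt => /orP[|//].
    by move=> /eqP/val_inj xw; rewrite -xw xX in wX.
  by rewrite {2}XE card_segment ?XE // ltnW.
pose Y := w |: X.
have [u [uX wu] cuw] : exists2 u, u \in X /\ w < u &
    #|[set y in Y | val y %% r == val w %% r]| <= #|[set y in Y | val y %% r == val u %% r]|.
  have [[u /and3P[uX wu /eqP uw]]|no_u] :=
      altP (@existsP _ (fun u : 'I_M => [&& u \in X, w < u & u %% r == w %% r])).
    by exists u => //; rewrite uw.
  exists u1 => //; pose q := w %/ r.
  (* Here the class of [w] in [Y] consists of [w] and smaller vertices. [f] sends [w] to [u1] and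
     gives each smaller one the residue of [u1] inside its block of [r] labels; the new label is
     below [w], hence in [X]. The default of [insubd] only makes [f] total. *)
  pose f (y : 'I_M) := if y < r * q then insubd u1 (r * (y %/ r) + u1 %% r) else u1.
  have rq_w : r * q <= w by rewrite mulnC leq_trunc_div.
  have fE (y : 'I_M) : y < r * q -> val (f y) = r * (y %/ r) + u1 %% r /\ f y < w.
    move=> yq; have bd : r * (y %/ r) + u1 %% r < w.
      have : y %/ r < q by rewrite ltn_divLR // mulnC.
      have := ltn_pmod u1 r0; nia.
    have fy : val (f y) = r * (y %/ r) + u1 %% r.
      by rewrite /f yq val_insubd (ltn_trans bd (ltn_ord w)).
    by split; rewrite -?[nat_of_ord (f y)]/(val (f y)) fy.
  have fE' (y : 'I_M) : r * q <= y -> f y = u1 by rewrite /f ltnNge => ->.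
  have Aw (y : 'I_M) : y \in [set y in Y | val y %% r == val w %% r] ->
      y <= w /\ val y %% r = val w %% r.
    rewrite !inE => /andP[yY /eqP yw]; split=> //.
    case/orP: yY => [/eqP->//|yX].
    rewrite leqNgt; apply: contra no_u => wy; apply/existsP; exists y.
    by rewrite yX wy yw eqxx.
  rewrite -(@card_in_imset _ _ f); last first.
    move=> y z /Aw[yw ymod] /Aw[zw zmod] fyz; apply: val_inj => /=.
    have [yq|yq] := ltnP y (r * q); have [zq|zq] := ltnP z (r * q).
    - have [fy _] := fE _ yq; have [fz _] := fE _ zq; move: fy fz; rewrite fyz => -> /addIn.
      move=> /eqP; rewrite eqn_mul2l => /orP[/eqP r00|/eqP yz]; first by rewrite r00 in r0.
      by rewrite (divn_eq y r) (divn_eq z r) yz ymod zmod.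
    - have [_ fy] := fE _ yq; move: fy; rewrite fyz fE' // => u1w.
      by have := ltn_trans wu1 u1w; rewrite ltnn.
    - have [_ fy] := fE _ zq; move: fy; rewrite -fyz fE' // => u1w.
      by have := ltn_trans wu1 u1w; rewrite ltnn.
    - have dv (x : nat) : x <= w -> r * q <= x -> x %/ r = q.
        move=> xw xq; apply/eqP; rewrite eqn_leq (leq_div2r r xw) /=.
        by rewrite leq_divRL // mulnC.
      by rewrite (divn_eq y r) (divn_eq z r) !dv // ymod zmod.
  apply/subset_leq_card/subsetP => _ /imsetP[y /Aw[yw ymod] ->].
  have [yq|yq] := ltnP y (r * q).
    have [fy fw] := fE _ yq; rewrite !inE belowX // orbT /= fy.
    by rewrite mulnC modnMDl modn_mod.
  by rewrite fE' // !inE u1X orbT eqxx.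
have YwX : Y :\ w = X by rewrite setU1K.
have uw : (u == w) = false by apply/eqP => uw; rewrite uw ltnn in wu.
have YuE : Y :\ u = w |: (X :\ u).
  by apply/setP => z; rewrite !inE; have [->|] := eqVneq z w; rewrite // eq_sym uw.
have wXu : w \notin X :\ u by rewrite !inE (negPf wX) andbF.
have cardYu : #|Y :\ u| = #|X|.
  by rewrite YuE cardsU1 wXu (cardsD1 u X) uX.
have uY : u \in Y by rewrite !inE uX orbT.
have le1 := @nmatch_multipartite_setD1 _ _ (fun x : 'I_M => val x %% r) l Y w u
  (setU11 _ _) uY cuw.
rewrite YwX in le1; apply: leq_trans le1 _.
rewrite nmatch_segment // -cardYu; apply: IH; rewrite YuE big_setU1 //=.
move: Xs; rewrite (big_setD1 u) //=; lia.
Qed.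

(** Adding all edges between colour classes only raises the count; the labels rank * [r] + colour
    then embed the result as an induced subgraph of a large Turan graph. *)
Lemma nmatch_partite_le (T : finType) (e : rel T) r l (U : {set T}) (c : T -> 'I_r) :
  {in U &, forall x y, e x y -> c x != c y} ->
  nmatch e l U <= turan_count r l #|U|.
Proof.
move=> c_proper; have [U0|[x0 _]] := set_0Vmem U.
  case: l => // l; rewrite nmatchS big_pred0 // => p.
  by rewrite /edge_in U0 inE.
have r0 : 0 < r by apply: leq_ltn_trans (ltn_ord (c x0)).
pose c' (x y : T) := c x != c y.
apply: (@leq_trans (nmatch c' l U)); first exact: nmatch_subrel.
have f_lt x : enum_rank x * r + c x < #|T| * r.
  apply: (@leq_trans ((enum_rank x).+1 * r)); first by rewrite mulSn addnC ltn_add2r.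
  by rewrite leq_mul2r ltn_ord orbT.
pose f x := Ordinal (f_lt x).
have f_inj : injective f.
  move=> x y /(congr1 val) /= /(congr1 (fun z => z %/ r)).
  rewrite !divnMDl // !divn_small // !addn0 => xy.
  by apply: enum_rank_inj; apply: val_inj.
rewrite -(@nmatch_imset _ _ c' (turan_rel (#|T| * r) r) f l U).
- by rewrite -(card_imset (mem U) f_inj); apply: nmatch_turan_subset.
- by move=> x y _ _; apply: f_inj.
- by move=> x y _ _; rewrite /turan_rel /= !modnMDl !modn_small // /c' -(inj_eq val_inj).
Qed.

(** * Turan graphs *)

Lemma turan_sym n r : symmetric (turan_rel n r).
Proof. by move=> x y; rewrite /turan_rel eq_sym. Qed.

Lemma turan_irr n r : irreflexive (turan_rel n r).
Proof. by move=> x; rewrite /turan_rel eqxx. Qed.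

Lemma residue_class_ge M n r a : n <= M -> a < r ->
  n %/ r <= #|[set y : 'I_M | (y < n) && (y %% r == a)]|.
Proof.
move=> nM ar; have r0 : 0 < r by apply: leq_ltn_trans ar.
have f_lt (k : 'I_(n %/ r)) : k * r + a < n.
  have := ltn_ord k; rewrite leq_divRL // mulSn; lia.
pose f k := Ordinal (leq_trans (f_lt k) nM).
rewrite -[leqLHS]card_ord -cardsT -(@card_imset _ _ f).
  apply/subset_leq_card/subsetP => _ /imsetP[k _ ->].
  by rewrite inE /= f_lt modnMDl modn_small // eqxx.
move=> k k' /(congr1 val) /= /addIn /eqP; rewrite eqn_pmul2r // => /eqP kk'.
by apply: val_inj.
Qed.

(** Below [n], a member [y] of the class that [n] joins is determined by [y %/ r], which is less
    than [n %/ r]. *)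
Lemma residue_class_le M n r : n <= M -> 0 < r ->
  #|[set y : 'I_M | (y < n) && (y %% r == n %% r)]| <= n %/ r.
Proof.
move=> nM r0; set A := [set y | _].
have [n_r|r_n] := ltnP n r.
  rewrite (_ : A = set0) ?cards0 //; apply/setP => y; rewrite !inE.
  apply/negP => /andP[yn]; rewrite !modn_small ?(ltn_trans yn) // => /eqP yn'.
  by rewrite yn' ltnn in yn.
have q0 : 0 < n %/ r by rewrite divn_gt0.
rewrite -[leqRHS]card_ord -[X in _ <= #|X|]/(xpredT : pred 'I_(n %/ r)).
pose f (y : 'I_M) : 'I_(n %/ r) := insubd (Ordinal q0) (y %/ r).
rewrite -(@card_in_imset _ _ f A); first exact: max_card.
have fE y : y \in A -> val (f y) = y %/ r.
  rewrite inE => /andP[yn /eqP ymod]; rewrite val_insubd.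
  case: ltnP => // ny; have := divn_eq y r; have := divn_eq n r; nia.
move=> y z yA zA fyz; apply: val_inj => /=.
rewrite (divn_eq y r) (divn_eq z r) -!fE // fyz.
by move: yA zA; rewrite !inE => /andP[_ /eqP->] /andP[_ /eqP->].
Qed.

(** The last vertex of [T_r(n+1)] lies in a largest class, so this is the minimum degree of that
    graph. *)
Lemma card_turan_nbr n r : 0 < r ->
  #|[set y in segment n.+1 n | turan_rel n.+1 r ord_max y]| = n - n %/ r.
Proof.
move=> r0; set A := [set y in _ | _].
pose B := [set y : 'I_n.+1 | (y < n) && (y %% r == n %% r)].
have cardB : #|B| = n %/ r.
  by apply/eqP; rewrite eqn_leq residue_class_le // residue_class_ge // ltn_pmod.
have nE : n = #|B| + #|A|.
  rewrite -[LHS](@card_segment n.+1 n) // -(cardsID B (segment n.+1 n)); congr (_ + _).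
    by apply: eq_card => y; rewrite !inE; do 2 case: (_ < _).
  apply: eq_card => y; rewrite !inE /turan_rel /= negb_and (eq_sym (n %% r)).
  by case: (_ < _); rewrite ?andbF ?andbT.
by rewrite -cardB [X in X - _]nE addKn.
Qed.

Lemma turan_count_rec r l n :
  turan_count r l.+1 n.+1 = turan_count r l.+1 n +
    2 * l.+1 * \sum_(y in [set y in segment n.+1 n | turan_rel n.+1 r ord_max y])
        nmatch (turan_rel n.+1 r) l (segment n.+1 n :\ y).
Proof.
have sE : [set: 'I_n.+1] :\ ord_max = segment n.+1 n.
  by apply/setP => x; rewrite !inE andbT -val_eqE /= ltn_neqAle -ltnS ltn_ord andbT.
rewrite {1}/turan_count (@nmatch_vertex _ _ (@turan_sym _ _) (@turan_irr _ _) _ _ ord_max) //.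
rewrite sE nmatch_segment //; congr (_ + _ * _); apply: eq_bigl => y.
rewrite !inE /= andbC; have [yn|yn] := ltnP y n; rewrite ?andbT ?andbF //=.
have -> : y = ord_max by apply: val_inj; apply/eqP; rewrite eqn_leq yn -ltnS ltn_ord.
by rewrite turan_irr.
Qed.

Lemma nmatch1_vertex (T : finType) (e : rel T) (U : {set T}) v :
  symmetric e -> irreflexive e -> v \in U ->
  nmatch e 1 U = nmatch e 1 (U :\ v) + 2 * deg e U v.
Proof.
move=> es ei vU; rewrite (nmatch_vertex es ei 0 vU) muln1 /deg -sum1_card; congr (_ + _ * _).
by apply: eq_bigl => y; rewrite inE.
Qed.

(** Twice the edge number of [T_r(n)] is (1 - 1/r) n^2 - b (r - b) / r with b = n mod r, here
    without denominators. The induction separates whether b + 1 wraps around to 0. *)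
Lemma turan_count_edges r n : 0 < r ->
  r * turan_count r 1 n + (n %% r) * (r - n %% r) = r.-1 * n ^ 2.
Proof.
move=> r0; elim: n => [|n IH].
  rewrite mod0n muln0 /turan_count nmatchS big_pred0 ?muln0 // => -[x y].
  by have := ltn_ord x.
rewrite turan_count_rec (eq_bigr (fun=> 1)) // sum1_card card_turan_nbr //.
move: IH; set N := turan_count r 1 n; have := divn_eq n r; have := ltn_pmod n r0.
set b := n %% r; set q := n %/ r => br nE IH.
have qn : q <= n by rewrite leq_div.
have [br1|br1] := ltnP b.+1 r.
  have -> : n.+1 %% r = b.+1 by rewrite nE -addnS modnMDl modn_small.
  clearbody N b q; have [d rE] : exists d, r = b + d.+2 by exists (r - b.+2); lia.
  have -> : n - q = q * (b + d.+1) + b by rewrite nE rE; lia.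
  have [rb rb1] : r - b = d.+2 /\ r - b.+1 = d.+1 by lia.
  have rp : r.-1 = b + d.+1 by lia.
  move: IH; rewrite rb rb1 rp nE rE; lia.
have -> : n.+1 %% r = 0.
  by rewrite nE -addnS modnMDl (_ : b.+1 = r) ?modnn //; apply/eqP; rewrite eqn_leq br br1.
clearbody N b q; have rE : r = b.+1 by lia.
have -> : n - q = q * b + b by rewrite nE rE; lia.
have [rb rp] : r - b = 1 /\ r.-1 = b by lia.
move: IH; rewrite rb rp nE rE; lia.
Qed.

Lemma turan_count_edges_le r n : 0 < r -> r * turan_count r 1 n <= r.-1 * n ^ 2.
Proof. by move=> r0; rewrite -turan_count_edges // leq_addr. Qed.

Lemma deg_turan_le n r (Y : {set 'I_n}) v : 0 < r -> deg (turan_rel n r) Y v <= n - n %/ r.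
Proof.
move=> r0; have := @residue_class_ge n n r (v %% r) (leqnn _) (ltn_pmod _ r0).
set A := [set y | _] => cA.
have : #|A| + deg (turan_rel n r) Y v <= n.
  rewrite -[leqRHS]card_ord -cardsT -(cardsID A setT) setTI leq_add2l.
  apply/subset_leq_card/subsetP => y; rewrite !inE /turan_rel ltn_ord /= andbT.
  by case/andP=> _; rewrite eq_sym.
have := leq_div n r; lia.
Qed.

(** Each of the [c] missing vertices costs at most [n - n %/ r] edges. As n^2 - 2cn = (n - c)^2 -
    c^2, the linear terms cancel and the error depends on [r] and [c] only. *)
Lemma turan_sub_edges_ge n r c (Y : {set 'I_n}) : 0 < r -> #|Y| + c = n ->
  r.-1 * #|Y| ^ 2 <= r * nmatch (turan_rel n r) 1 Y + (r ^ 2 + 2 * c * r + r * c ^ 2).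
Proof.
move=> r0 cY; have main : r.-1 * n ^ 2 <=
    r * nmatch (turan_rel n r) 1 Y + (r ^ 2 + 2 * c * (r.-1 * n + r)).
  elim: c Y cY => [|c IH] Y cY.
    have -> : Y = setT by apply/eqP; rewrite eqEcard subsetT cardsT card_ord; lia.
    rewrite -(turan_count_edges n r0) /turan_count muln0 mul0n addn0 leq_add2l -mulnn.
    by apply: leq_mul; rewrite ?leq_subr // ltnW // ltn_pmod.
  have [v vY] : exists v, v \notin Y.
    apply/existsP; rewrite -[X in is_true X]negbK negb_exists; apply/negP => /forallP Yall.
    have YE : Y = setT by apply/setP => x; rewrite inE; apply/negPn/Yall.
    by move: cY; rewrite YE cardsT card_ord; lia.
  have vYv : v \in v |: Y by rewrite setU11.
  have := IH (v |: Y); rewrite cardsU1 vY add1n addSnnS => /(_ cY).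
  rewrite (nmatch1_vertex (@turan_sym _ _) (@turan_irr _ _) vYv) setU1K //.
  have := deg_turan_le (v |: Y) v r0; have := divn_eq n r; have := ltn_pmod n r0.
  set d := deg _ _ _; set h := nmatch _ _ _; set q := n %/ r; set b := n %% r => br nE dq H.
  have rd : r * d <= r.-1 * n + r.
    apply: (@leq_trans (r * (n - q))); first by rewrite leq_mul2l dq orbT.
    rewrite mulnBr -subn1 mulnBl mul1n; lia.
  nia.
have [cn YE] : c <= n /\ #|Y| = n - c by lia.
move: main; rewrite YE; move: (nmatch _ _ _) => h.
have := subnK cn; move: (n - c) => m <-; case: r r0 => //= r _; lia.
Qed.

(** The product of [r.-1 * (m - 2 * i) ^ 2] over [i < k]: the Turan edge bound applied to [k] edges
    chosen successively, with the denominator [r ^ k] cleared. *)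
Fixpoint mbound (r k m : nat) : nat :=
  if k is k'.+1 then r.-1 * m ^ 2 * mbound r k' (m - 2) else 1.

Lemma mbound_le r k m n : m <= n -> mbound r k m <= r ^ k * n ^ (2 * k).
Proof.
elim: k m => [//|k IH] m mn /=.
rewrite mulnS expnD (expnS r) mulnACA; apply: leq_mul; last by apply: IH; lia.
by apply: leq_mul; [exact: leq_pred | rewrite leq_exp2r].
Qed.

(** Every factor of the product is at least [(m - 2 * k) ^ 2], hence at least a quarter of
    [n ^ 2]. *)
Lemma mbound_ge r k m n : 1 < r -> n <= 2 * (m - 2 * k) -> n ^ (2 * k) <= 4 ^ k * mbound r k m.
Proof.
move=> r1; elim: k m => [//|k IH] m mn /=.
rewrite mulnS expnD (expnS 4) mulnACA; apply: leq_mul; last by apply: IH; lia.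
have nm : n ^ 2 <= (2 * m) ^ 2 by rewrite leq_exp2r //; lia.
apply: leq_trans nm _; rewrite expnMn leq_mul2l /=; apply: leq_pmull; lia.
Qed.

Lemma card_setD_edge (T : finType) (e : rel T) (U : {set T}) p : irreflexive e ->
  edge_in e U p -> #|U :\ p.1 :\ p.2|.+2 = #|U|.
Proof.
move=> ei /and3P[p1 p2 ep]; rewrite (cardsD1 p.1 U) p1 (cardsD1 p.2 (U :\ p.1)) !inE p2 andbT.
by case: eqP => // pp; rewrite pp ei in ep.
Qed.

Lemma nmatch1_le (T : finType) (e : rel T) (U : {set T}) : nmatch e 1 U <= #|U| ^ 2.
Proof.
rewrite nmatchS /nmatch sum1_card -mulnn -cardsX; apply/subset_leq_card/subsetP => p.
by rewrite inE => /and3P[-> ->].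
Qed.

(** The discrepancy has order n^(2k-2); the factor [n ^ 2] avoids negative exponents. The first edge
    has the right number of choices up to a constant, and each choice leaves a set with two more
    vertices missing, which is why [c] varies in the induction. *)
Lemma nmatch_turan_ge r k c : 0 < r -> exists C, forall n (Y : {set 'I_n}), #|Y| + c = n ->
  n ^ 2 * mbound r k #|Y| <= n ^ 2 * (r ^ k * nmatch (turan_rel n r) k Y) + C * n ^ (2 * k).
Proof.
move=> r0; elim: k c => [|k IH] c; first by exists 0 => n Y _; rewrite mul0n addn0; apply: leqnn.
have [C HC] := IH c.+2; pose C0 := r ^ 2 + 2 * c * r + r * c ^ 2.
(* [r * C] collects the inductive errors over at most [n ^ 2] first edges; [C0 * r ^ k] is the
   constant error of the edge count times the bound on the rest. *)
exists (r * C + C0 * r ^ k) => n Y cY /=.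
have edges := turan_sub_edges_ge r0 cY; rewrite -/C0 in edges.
have Yn : #|Y| <= n by lia.
have bound := @mbound_le r k (#|Y| - 2) n (leq_trans (leq_subr _ _) Yn).
have E_le := nmatch1_le (turan_rel n r) Y.
pose E := nmatch (turan_rel n r) 1 Y; rewrite -/E in edges E_le.
pose A := n ^ 2 * mbound r k (#|Y| - 2); pose H := nmatch (turan_rel n r) k.+1 Y.
have EA : E * A <= n ^ 2 * (r ^ k * H) + E * (C * n ^ (2 * k)).
  have EX x : E * x = \sum_(p | edge_in (turan_rel n r) Y p) x.
    by rewrite /E nmatchS big_distrl; apply: eq_bigr => p _; apply: mul1n.
  rewrite !EX /H nmatchS 2!big_distrr -big_split /=; apply: leq_sum => p pY.
  have := card_setD_edge (@turan_irr _ _) pY => cp.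
  have := HC _ (Y :\ p.1 :\ p.2); rewrite /A -cp subSS subSS subn0; apply.
  by rewrite -[RHS]cY -[in RHS]cp !addSnnS.
rewrite -/H.
have -> : n ^ 2 * (r.-1 * #|Y| ^ 2 * mbound r k (#|Y| - 2)) = r.-1 * #|Y| ^ 2 * A.
  by rewrite /A mulnCA.
apply: (@leq_trans ((r * E + C0) * A)); first by rewrite leq_mul2r edges orbT.
have A_le : A <= r ^ k * n ^ (2 * k.+1).
  by rewrite /A mulnS expnD mulnCA leq_mul2l bound orbT.
have EC : E * (C * n ^ (2 * k)) <= C * n ^ (2 * k.+1).
  rewrite mulnS expnD mulnCA leq_mul2l leq_mul2r (leq_trans E_le) ?orbT //.
  by rewrite leq_exp2r.
rewrite mulnDl -mulnA.
apply: (@leq_trans (r * (n ^ 2 * (r ^ k * H) + C * n ^ (2 * k.+1)) + C0 * (r ^ k * n ^ (2 * k.+1)))).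
  apply: leq_add; rewrite leq_mul2l ?A_le ?orbT //.
  by rewrite (leq_trans EA) ?leq_add2l ?EC ?orbT.
rewrite (expnS r); move: (n ^ 2) (r ^ k) (n ^ (2 * k.+1)) => N2 R P; lia.
Qed.

(** Choose the edges one at a time; starting from [m0 + 2 * k] vertices, every intermediate set
    stays above the threshold [m0]. *)
Lemma nmatch_le_mbound (T : finType) (e : rel T) r m0 : irreflexive e ->
  (forall U : {set T}, m0 <= #|U| -> r * nmatch e 1 U <= r.-1 * #|U| ^ 2) ->
  forall k (U : {set T}), m0 + 2 * k <= #|U| -> r ^ k * nmatch e k U <= mbound r k #|U|.
Proof.
move=> ei edges; elim=> [//|k IH] U mU /=; rewrite nmatchS.
have le1 : r ^ k * \sum_(p | edge_in e U p) nmatch e k (U :\ p.1 :\ p.2) <=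
    nmatch e 1 U * mbound r k (#|U| - 2).
  rewrite nmatchS big_distrr big_distrl /=; apply: leq_sum => p pU.
  have cp := card_setD_edge ei pU; rewrite {2}/nmatch mul1n -cp subSS subSS subn0.
  by apply: IH; lia.
rewrite expnS -mulnA; apply: (@leq_trans (r * (nmatch e 1 U * mbound r k (#|U| - 2)))).
  by rewrite leq_mul2l le1 orbT.
by rewrite mulnA leq_mul2r edges ?orbT //; lia.
Qed.

(* Dropping one edge at [v] loses a term of order [n ^ (2 * k)], which beats the
   accumulated discrepancy, of order [n ^ (2 * k - 1)], of the Turan graph
   from the bound [mbound]. *)
Lemma nmatch_low_degree r k : 0 < r -> exists n0, forall (T : finType) (e : rel T)
    (U : {set T}) v n,
  symmetric e -> irreflexive e -> n0 <= n -> #|U| = n.+1 -> v \in U ->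
  deg e U v < n - n %/ r ->
  (forall W : {set T}, W \subset U -> #|W|.+1 = n -> r ^ k * nmatch e k W <= mbound r k #|W|) ->
  nmatch e k.+1 U + turan_count r k.+1 n < nmatch e k.+1 (U :\ v) + turan_count r k.+1 n.+1.
Proof.
(* The [2] stands for the last vertex of [T_r(n+1)] and its partner. *)
move=> r0; have [C HC] := nmatch_turan_ge k 2 r0.
(* [4 * k + 4] makes [mbound_ge] available on [n.-1] vertices; [C * 4 ^ k] contradicts the final
   inequality. *)
exists (C * 4 ^ k + 4 * k + 4) => T e U v n es ei n0 cU vU dv upper.
have r1 : 1 < r by case: r {upper HC} r0 dv => [|[|r]] //; rewrite divn1 subnn.
rewrite (nmatch_vertex es ei _ vU) turan_count_rec.
set SU := \sum_(y in U | _) _; set S := [set y in _ | _]; set ST := \sum_(y in S) _.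
suff: SU < ST by nia.
(* [Q] is the common size expected of all summands, scaled by [r ^ k]; [ST] has at least one summand
   more than [SU]. *)
pose Q := mbound r k n.-1; rewrite ltnNge; apply/negP => ST_SU.
have SU_le : r ^ k * SU <= deg e U v * Q.
  have -> : deg e U v * Q = \sum_(y in U | e v y) Q.
    by rewrite /deg -sum_nat_const; apply: eq_bigl => y; rewrite inE.
  rewrite /SU big_distrr /=; apply: leq_sum => y /andP[yU vy].
  have vy' : edge_in e U (v, y) by rewrite /edge_in /= vU yU.
  have /= cW := card_setD_edge ei vy'.
  have cW' : #|U :\ v :\ y|.+1 = n by move: cW; rewrite cU => -[].
  rewrite /Q -cW' /=; apply: upper => //.
  by apply: subset_trans (subsetDl _ _) (subsetDl _ _).
have ST_ge : (n - n %/ r) * (n.+1 ^ 2 * Q) <=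
    n.+1 ^ 2 * (r ^ k * ST) + (n - n %/ r) * (C * n.+1 ^ (2 * k)).
  rewrite -card_turan_nbr // -/S -!sum_nat_const /ST !big_distrr /= -big_split /=.
  apply: leq_sum => y; rewrite inE => /andP[yn _].
  have cy := cardsD1 y (segment n.+1 n); rewrite yn card_segment // add1n in cy.
  have cy' : #|segment n.+1 n :\ y| = n.-1 by move: cy => /(congr1 predn) /= <-.
  rewrite /Q -[in mbound _ _ _]cy'; apply: HC; rewrite cy'; lia.
have Qge : n.+1 ^ (2 * k) <= 4 ^ k * Q by apply: mbound_ge => //; lia.
have Q0 : 0 < Q.
  by move: Qge; case: (Q) => //; rewrite muln0 leqn0 expn_eq0.
have Dn : n - n %/ r <= n.+1 by rewrite leqW // leq_subr.
move: SU_le ST_ge ST_SU dv Qge Dn n0; set d := deg _ _ _; set D := n - _.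
move: (r ^ k) (n.+1 ^ (2 * k)) (4 ^ k) => R P F SU_le ST_ge ST_SU dv Qge Dn n0.
have a1 : n.+1 ^ 2 * (R * ST) <= n.+1 ^ 2 * (d * Q).
  by rewrite leq_mul2l (leq_trans _ SU_le) ?orbT // leq_mul2l ST_SU orbT.
have a2 : D * (C * P) <= n.+1 * (C * (F * Q)).
  by apply: leq_mul => //; rewrite leq_mul2l Qge orbT.
have a3 : d.+1 * (n.+1 ^ 2 * Q) <= D * (n.+1 ^ 2 * Q) by rewrite leq_mul2r dv orbT.
have a4 : n.+1 ^ 2 * Q <= n.+1 * (C * (F * Q)) by nia.
have : n.+1 * (n.+1 * Q) <= n.+1 * (C * F * Q) by rewrite -mulnA; nia.
rewrite leq_mul2l /= leq_mul2r (gtn_eqF Q0) /=; lia.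
Qed.

(** * Complete multipartite subgraphs *)

Lemma card_bigcup_le (I : finType) (T : finType) (P : pred I) (F : I -> {set T}) :
  #|\bigcup_(i | P i) F i| <= \sum_(i | P i) #|F i|.
Proof.
elim/big_rec2: _ => [|i m A _ IH]; first by rewrite cards0.
by apply: leq_trans (leq_card_setU _ _) _; rewrite leq_add2l.
Qed.

Lemma subset_with_card (T : finType) (A : {set T}) s : s <= #|A| ->
  exists2 B : {set T}, B \subset A & #|B| = s.
Proof.
move=> sA; exists [set x in take s (enum A)].
  by apply/subsetP => x; rewrite inE => /mem_take; rewrite mem_enum.
rewrite cardsE; have /card_uniqP-> := take_uniq s (enum_uniq A).
by rewrite size_takel // -cardE.
Qed.

Lemma card_setI_pred2 (T : finType) (X : {set T}) (P Q : pred T) :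
  #|X| <= #|[set a in X | P a && Q a]| + #|[set a in X | ~~ P a]| + #|[set a in X | ~~ Q a]|.
Proof.
apply: (@leq_trans #|([set a in X | P a && Q a] :|: [set a in X | ~~ P a])
                      :|: [set a in X | ~~ Q a]|).
  apply/subset_leq_card/subsetP => a aX; rewrite !inE aX /=.
  by case: (P a); case: (Q a).
apply: leq_trans (leq_card_setU _ _) _; rewrite leq_add2r; exact: leq_card_setU.
Qed.

Lemma card_setID_pred (T : finType) (X : {set T}) (P : pred T) :
  #|[set a in X | P a]| + #|[set a in X | ~~ P a]| = #|X|.
Proof.
rewrite -(cardsID [set a | P a] X); congr (_ + _); apply: eq_card => a.
  by rewrite !inE andbC.
by rewrite !inE andbC.
Qed.

Section Parts.
Variables (T : finType) (e : rel T).
Hypothesis e_sym : symmetric e.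

Definition complete_parts (p : nat) (A : nat -> {set T}) : Prop :=
  forall i j, i < p -> j < p -> i != j -> forall x y, x \in A i -> y \in A j -> e x y.

(** For irreflexive [e], a vertex of [U] is among its own non-neighbours. *)
Definition nonnbr (U : {set T}) (v : T) : {set T} := [set y in U | ~~ e v y].

(** Double counting: by symmetry the sum runs over the [p * s] vertices of the parts, each with at
    most [b] non-neighbours in [U]. *)
Lemma sum_nonnbr_parts (U : {set T}) p s b (A : nat -> {set T}) :
  (forall v, v \in U -> #|nonnbr U v| <= b) ->
  (forall i, i < p -> A i \subset U /\ #|A i| = s) ->
  \sum_(v in U) \sum_(i < p) #|nonnbr (A i) v| <= p * s * b.
Proof.
move=> nb AU; rewrite exchange_big /= -mulnA -[p in leqRHS]card_ord -sum_nat_const.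
apply: leq_sum => i _; have [AiU <-] := AU i (ltn_ord i).
rewrite -sum_nat_const.
under eq_bigr do rewrite /nonnbr -sum1_card.
rewrite (exchange_big_dep (mem (A i))) /=; last by move=> v a _; rewrite inE => /andP[].
apply: leq_sum => a aA; have aU := subsetP AiU a aA.
apply: leq_trans (nb a aU); rewrite -sum1_card.
rewrite [leqRHS](eq_bigl (fun v => (v \in U) && (a \in nonnbr (A i) v))) //.
by move=> v; rewrite !inE aA (e_sym v).
Qed.

(** Parts are chosen one after another; the vertices chosen so far rule out at most [r * t * C]
    vertices of the next set. *)
Lemma greedy_parts r t C (B : nat -> {set T}) :
  (forall i, i < r -> t + r * t * C <= #|B i|) ->
  (forall i j, i < r -> j < r -> i != j -> forall x, x \in B i -> #|nonnbr (B j) x| <= C) ->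
  exists A, complete_parts r A /\ forall i, i < r -> A i \subset B i /\ #|A i| = t.
Proof.
move=> cB nB; suff: forall p, p <= r -> exists A, complete_parts p A /\
    forall i, i < p -> A i \subset B i /\ #|A i| = t by apply.
elim=> [_|p IH pr]; first by exists (fun=> set0).
have [A [A_compl A_sub]] := IH (ltnW pr).
pose D := \bigcup_(i < p) \bigcup_(a in A i) nonnbr (B p) a.
have cD : #|D| <= r * t * C.
  apply: (@leq_trans (p * t * C)); last by rewrite -!mulnA leq_mul2r ltnW ?orbT.
  apply: leq_trans (card_bigcup_le _ _) _.
  rewrite -mulnA -[p in leqRHS]card_ord -sum_nat_const; apply: leq_sum => i _.
  apply: leq_trans (card_bigcup_le _ _) _.
  have [AB <-] := A_sub i (ltn_ord i); rewrite -sum_nat_const; apply: leq_sum => a aA.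
  by apply: (nB i p) => //; [exact: ltn_trans pr | rewrite ltn_eqF | exact: (subsetP AB)].
have [S SBD cS] : exists2 S : {set T}, S \subset B p :\: D & #|S| = t.
  apply: subset_with_card; rewrite cardsD.
  have := cB p pr; have := subset_leq_card (subsetIr (B p) D); lia.
have SB : S \subset B p by apply: subset_trans SBD (subsetDl _ _).
have AS i x y : i < p -> x \in A i -> y \in S -> e x y.
  move=> ip xA yS; have := subsetP SBD y yS; rewrite inE => /andP[yD yB].
  apply: contraR yD => exy; apply/bigcupP; exists (Ordinal ip) => //.
  by apply/bigcupP; exists x => //; rewrite inE yB.
exists (fun i => if i == p then S else A i); split.
  move=> i j; rewrite !ltnS; have [->|ip] := eqVneq i p; have [->|jp] := eqVneq j p.
  - by [].
  - move=> _ jp' _ x y xS yA; rewrite e_sym; apply: (AS j) => //.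
    by rewrite ltn_neqAle jp.
  - by move=> ip' _ _ x y xA yS; apply: (AS i) => //; rewrite ltn_neqAle ip.
  - by move=> ip' jp'; apply: A_compl; rewrite ltn_neqAle ?ip ?jp.
move=> i; rewrite ltnS; have [->//|ip ip'] := eqVneq i p.
by apply: A_sub; rewrite ltn_neqAle ip.
Qed.

End Parts.

(* With parts of size [t] already found, many vertices have [s] neighbours in
   each of them, and many of these have the same neighbourhood in the parts. *)
Lemma erdos_stone_min_degree r p s : p <= r -> exists n0, forall (T : finType) (e : rel T)
    (U : {set T}) b,
  symmetric e -> n0 <= #|U| -> r * b <= #|U| + r ->
  (forall v, v \in U -> #|nonnbr e U v| <= b) ->
  exists A, complete_parts e p A /\ forall i, i < p -> A i \subset U /\ #|A i| = s.
Proof.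
elim: p s => [|p IH] s pr; first by exists 0 => T e U b _ _ _ _; exists (fun=> set0).
pose t := 2 * r * s.+1; have [m0 Hm] := IH t (ltnW pr).
pose K := s * 2 ^ (r * t).
exists (m0 + 2 * r * K.+1 + 2 * r ^ 2) => T e U b es Un rb nb.
have [] := Hm T e U b es _ rb nb; first by apply: leq_trans Un; rewrite -addnA leq_addr.
move=> A [A_compl A_sub].
pose W := [set v in U | [forall i : 'I_p, s <= #|[set a in A i | e v a]|]].
have WU : W \subset U by apply/subsetP => v; rewrite inE => /andP[].
have cW : K < #|W|.
  have := sum_nonnbr_parts es nb A_sub; set S := \sum_(v in U) _ => S_le.
  have : (#|U| - #|W|) * ((2 * r - 1) * s.+1) <= S.
    rewrite -(cardsDS WU) -sum_nat_const /S [leqRHS](big_setID W) /=.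
    apply: leq_trans (leq_addl _ _); apply: leq_sum => v.
    rewrite !inE => /andP[vW vU]; rewrite vU /= in vW.
    have /existsP[i] : [exists i : 'I_p, #|[set a in A i | e v a]| < s].
      apply: contraR vW => /existsPn H.
      by apply/forallP => i; rewrite leqNgt H.
    move=> si; rewrite (bigD1 i) //=; apply: leq_trans (leq_addr _ _).
    have [_ cA] := A_sub i (ltn_ord i).
    have := card_setID_pred (A i) (e v); rewrite cA -/(nonnbr e (A i) v) /t; nia.
  move=> S_ge; have {S_ge S_le} : (#|U| - #|W|) * ((2 * r - 1) * s.+1) <= p * t * b.
    exact: leq_trans S_ge S_le.
  rewrite /t => ineq.
  have {}ineq : (#|U| - #|W|) * (2 * r - 1) <= p * (2 * (r * b)).
    by rewrite -(leq_pmul2r (ltn0Sn s)); lia.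
  have : p * (2 * (r * b)) <= r.-1 * (2 * (#|U| + r)).
    by apply: leq_mul; [lia | rewrite leq_mul2l rb orbT].
  have arith q n w : (n - w) * (2 * q.+1 - 1) <= q * (2 * (n + q.+1)) -> w <= n ->
      2 * q.+1 * K.+1 + 2 * q.+1 ^ 2 <= n -> K < w.
    move=> h1 wn h2; rewrite ltnNge; apply/negP => wK.
    have h3 : w * (2 * q + 1) <= K * (2 * q + 1) by rewrite leq_mul2r wK orbT.
    have e1 : 2 * q.+1 - 1 = 2 * q + 1 by lia.
    move: h1 h2; rewrite -mulnn e1 -{2 3}(subnK wn); move: (n - w) => d; lia.
  move=> h; apply: (arith r.-1 #|U|); rewrite ?(ltn_predK pr).
  - exact: leq_trans ineq h.
  - exact: subset_leq_card.
  - by apply: leq_trans Un; rewrite -addnA leq_addl.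
pose Ap := \bigcup_(i < p) A i.
pose key v := [set a in Ap | e v a].
have cAp : #|powerset Ap| <= 2 ^ (r * t).
  rewrite card_powerset leq_exp2l //; apply: leq_trans (card_bigcup_le _ _) _.
  rewrite (eq_bigr (fun=> t)) => [|i _]; last by have [] := A_sub i (ltn_ord i).
  by rewrite sum_nat_const card_ord leq_mul2r ltnW ?orbT.
have [k0 sk0] : exists k, s < #|[set v in W | key v == k]|.
  apply/existsP; apply: contraLR cW => /existsPn fib; rewrite -leqNgt.
  rewrite -sum1_card (partition_big key (mem (powerset Ap))) /=; last first.
    by move=> v _; rewrite inE; apply/subsetP => a; rewrite inE => /andP[].
  apply: (@leq_trans (\sum_(k in powerset Ap) s)).
    apply: leq_sum => k _; have := fib k; rewrite -leqNgt; apply: leq_trans.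
    by rewrite -sum1_card; apply/eq_leq/eq_bigl => v; rewrite !inE.
  by rewrite sum_nat_const mulnC leq_mul2l cAp orbT.
have [w] : exists w, w \in [set v in W | key v == k0].
  by apply/set0Pn; rewrite -card_gt0; apply: leq_ltn_trans sk0.
rewrite inE => /andP[wW /eqP kw].
have [S SW cS] := subset_with_card (ltnW sk0).
have subA (i : nat) : exists B : {set T},
    (i < p) ==> (B \subset [set a in A i | e w a]) && (#|B| == s).
  have [ip|] := ltnP i p; last by exists set0.
  have [B BA cB] : exists2 B : {set T}, B \subset [set a in A i | e w a] & #|B| = s.
    apply: subset_with_card; move: wW; rewrite inE => /andP[_ /forallP].
    by move/(_ (Ordinal ip)).
  by exists B; rewrite BA cB eqxx.
pose B i := xchoose (subA i).
have HB i : i < p -> B i \subset [set a in A i | e w a] /\ #|B i| = s.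
  by move=> ip; have /andP[-> /eqP->] := implyP (xchooseP (subA i)) ip.
have BS i x y : i < p -> x \in B i -> y \in S -> e x y.
  move=> ip xB yS; have [BA _] := HB i ip; have := subsetP BA x xB.
  rewrite inE => /andP[xA wx]; have := subsetP SW y yS; rewrite inE => /andP[_ /eqP ky].
  have xAp : x \in Ap by apply/bigcupP; exists (Ordinal ip).
  have : x \in key y by rewrite ky -kw inE xAp.
  by rewrite inE es => /andP[].
exists (fun i => if i == p then S else B i); split.
  move=> i j; rewrite !ltnS; have [->|ip] := eqVneq i p; have [->|jp] := eqVneq j p.
  - by [].
  - move=> _ jp' _ x y xS yA; rewrite es; apply: (BS j) => //.
    by rewrite ltn_neqAle jp.
  - by move=> ip' _ _ x y xA yS; apply: (BS i) => //; rewrite ltn_neqAle ip.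
  - move=> ip' jp' ij x y xB yB.
    have ip1 : i < p by rewrite ltn_neqAle ip.
    have jp1 : j < p by rewrite ltn_neqAle jp.
    apply: (A_compl i j) => //.
      by have [/subsetP/(_ x xB) + _] := HB i ip1; rewrite inE => /andP[].
    by have [/subsetP/(_ y yB) + _] := HB j jp1; rewrite inE => /andP[].
move=> i; rewrite ltnS; have [-> _|ip ip'] := eqVneq i p.
  split=> //; apply: subset_trans SW _; apply: subset_trans WU.
  by apply/subsetP => v; rewrite inE => /andP[].
have ip1 : i < p by rewrite ltn_neqAle ip.
have [BA cB] := HB i ip1; split=> //; have [AU _] := A_sub i ip1.
apply: subset_trans BA _; apply: subset_trans AU.
by apply/subsetP => v; rewrite inE => /andP[].
Qed.

(** * Graphs of large minimum degree *)

Definition critical_coloring (V : finType) (eF : rel V) (r : nat) (c : V -> nat) (u v : V) :=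
  [/\ forall w, c w < r, u != v, c u = c v &
      forall w w', eF w w' -> [\/ c w != c w', w = u /\ w' = v | w = v /\ w' = u]].

Section Structure.
Variables (V : finType) (eF : rel V) (r : nat) (cF : V -> nat) (u0 v0 : V).
Hypothesis cF_crit : critical_coloring eF r cF u0 v0.

Lemma contains_parts (T : finType) (e : rel T) (A : nat -> {set T}) i x y :
  symmetric e -> irreflexive e ->
  complete_parts e r A -> (forall j, j < r -> #|V| <= #|A j|) ->
  i < r -> e x y ->
  (forall j a, j < r -> j != i -> a \in A j -> e x a && e y a) ->
  contains e eF.
Proof.
move=> es ei A_compl cA ir exy Axy; have [cF_r uv cuv cF_col] := cF_crit.
pose sw j := if j == i then cF u0 else if j == cF u0 then i else j.
have sw_inj : injective sw by move=> j k; rewrite /sw; do !case: eqP => //; congruence.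
have sw_r j : j < r -> sw j < r by rewrite /sw; do !case: eqP.
pose A' w := A (sw (cF w)) :\ x :\ y.
pose others := enum (~: [set u0; v0]).
have size_others : (size others).+2 = #|V|.
  have := cardsC [set u0; v0]; rewrite cards2 uv /others -cardE; lia.
have cA' w : size others <= size (enum (A' w)).
  rewrite -cardE /A'; have := cardsD1 y (A (sw (cF w)) :\ x).
  have := cardsD1 x (A (sw (cF w))); have := cA _ (sw_r _ (cF_r w)); lia.
pose f w := if w == u0 then x else if w == v0 then y else nth x (enum (A' w)) (index w others).
have mem_others w : w != u0 -> w != v0 -> w \in others.
  by move=> wu wv; rewrite mem_enum !inE negb_or wu.
have idx w : w != u0 -> w != v0 -> index w others < size (enum (A' w)).
  by move=> wu wv; apply: leq_trans (cA' w); rewrite index_mem mem_others.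
have fA w : w != u0 -> w != v0 -> f w \in A' w.
  by move=> wu wv; rewrite /f (negPf wu) (negPf wv) -mem_enum mem_nth ?idx.
have fA0 w : w != u0 -> w != v0 -> f w \in A (sw (cF w)).
  by move=> wu wv; have := fA w wu wv; rewrite !inE => /and3P[].
have fxy w : w != u0 -> w != v0 -> cF w != cF u0 -> e x (f w) && e y (f w).
  move=> wu wv cw; apply: (Axy (sw (cF w))); rewrite ?sw_r ?fA0 //.
  have -> : i = sw (cF u0) by rewrite /sw eqxx; case: eqP.
  by rewrite (inj_eq sw_inj).
have fcol w w' : w != u0 -> w != v0 -> w' != u0 -> w' != v0 -> cF w != cF w' -> e (f w) (f w').
  move=> wu wv wu' wv' cw; apply: (A_compl (sw (cF w)) (sw (cF w'))); rewrite ?sw_r ?fA0 //.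
  by rewrite (inj_eq sw_inj).
have fu : f u0 = x by rewrite /f eqxx.
have fv : f v0 = y by rewrite /f eqxx eq_sym (negPf uv).
have f_edge w w' : eF w w' -> e (f w) (f w').
  move=> ww'; case: (cF_col _ _ ww') => [cww'|[-> ->]|[-> ->]]; rewrite ?fu ?fv //; last by rewrite es.
  have [wu|wu] := eqVneq w u0.
    have [wu'|wu'] := eqVneq w' u0; first by rewrite wu wu' eqxx in cww'.
    have [wv'|wv'] := eqVneq w' v0; first by rewrite wu wv' cuv eqxx in cww'.
    by rewrite wu eq_sym in cww'; rewrite wu fu; case/andP: (fxy w' wu' wv' cww').
  have [wv|wv] := eqVneq w v0.
    have [wu'|wu'] := eqVneq w' u0; first by rewrite wv wu' cuv eqxx in cww'.
    have [wv'|wv'] := eqVneq w' v0; first by rewrite wv wv' eqxx in cww'.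
    by rewrite wv -cuv eq_sym in cww'; rewrite wv fv; case/andP: (fxy w' wu' wv' cww').
  have [wu'|wu'] := eqVneq w' u0.
    by rewrite wu' in cww'; rewrite wu' fu es; case/andP: (fxy w wu wv cww').
  have [wv'|wv'] := eqVneq w' v0.
    by rewrite wv' -cuv in cww'; rewrite wv' fv es; case/andP: (fxy w wu wv cww').
  exact: fcol.
have fneq w : w != u0 -> w != v0 -> (f w != x) && (f w != y).
  by move=> wu wv; have := fA w wu wv; rewrite !inE => /and3P[-> ->].
have xy : x != y by apply: contraTneq exy => ->; rewrite ei.
apply/existsP; exists [ffun w => f w]; apply/andP; split; last first.
  by apply/forallP => w; apply/forallP => w'; apply/implyP; rewrite !ffunE; apply: f_edge.
apply/injectiveP => w w'; rewrite !ffunE.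
have [->|wu] := eqVneq w u0; have [->|wu'] := eqVneq w' u0 => //.
- have [->|wv'] := eqVneq w' v0; first by rewrite fu fv => /eqP; rewrite (negPf xy).
  by move=> ff; have := fneq w' wu' wv'; rewrite -ff fu eqxx.
- have [->|wv] := eqVneq w v0; first by rewrite fu fv => /esym /eqP; rewrite (negPf xy).
  by move=> ff; have := fneq w wu wv; rewrite ff fu eqxx.
have [->|wv] := eqVneq w v0; have [->|wv'] := eqVneq w' v0 => //.
- by move=> ff; have := fneq w' wu' wv'; rewrite -ff fv eqxx andbF.
- by move=> ff; have := fneq w wu wv; rewrite ff fv eqxx andbF.
move=> ff; have [cww'|cww'] := eqVneq (cF w) (cF w'); last first.
  by have := fcol w w' wu wv wu' wv' cww'; rewrite ff ei.
have A'E : A' w = A' w' by rewrite /A' cww'.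
move: ff; rewrite /f (negPf wu) (negPf wv) (negPf wu') (negPf wv') A'E => /eqP.
rewrite nth_uniq ?enum_uniq ?idx // -?A'E ?idx // => /eqP.
exact: (index_inj u0 (mem_others w wu wv) (mem_others w' wu' wv')).
Qed.

(* All but boundedly many vertices see exactly [r - 1] full parts of a complete
   [r]-partite subgraph; the classes [W i] they form almost cover [U], and every
   remaining vertex avoids one of these classes completely. *)
Lemma partite_of_min_degree : 0 < r -> exists n0, forall (T : finType) (e : rel T)
    (U : {set T}) n,
  symmetric e -> irreflexive e -> ~~ contains e eF -> n0 <= n -> #|U| = n.+1 ->
  (forall v, v \in U -> n - n %/ r <= deg e U v) ->
  exists c : T -> 'I_r, {in U &, forall x y, e x y -> c x != c y}.
Proof.
move=> r0; pose t := #|V|; pose s := 2 * t; pose C := s * r + r; pose G := t + r * t * C.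
have [_ uv _ _] := cF_crit.
have t2 : 1 < t by rewrite /t (cardD1 u0) (cardD1 v0) !inE eq_sym uv.
have [n1 Hn1] := erdos_stone_min_degree s (leqnn r).
exists (n1 + r * (2 * G + 4 * C)) => T e U n es ei free Un cU mind.
pose b := n %/ r + 1.
have nb v : v \in U -> #|nonnbr e U v| <= b.
  move=> vU; have := mind v vU; have := card_setID_pred U (e v).
  rewrite -/(deg e U v) -/(nonnbr e U v) cU /b; have := leq_div n r; lia.
have rb : r * b <= n + r by rewrite /b mulnDr muln1 leq_add2r mulnC leq_trunc_div.
have b_big : 2 * G + 4 * C < b.
  rewrite /b addn1 ltnS leq_divRL // mulnC; apply: leq_trans Un; exact: leq_addl.
have [] := Hn1 T e U b es _ _ nb.
- by rewrite cU; apply: leq_trans (leqnSn n); apply: leq_trans Un; apply: leq_addr.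
- by rewrite cU; apply: leq_trans rb _; rewrite leq_add2r.
move=> P [P_compl P_sub].
have freeP A i x y : complete_parts e r A -> (forall j, j < r -> t <= #|A j|) ->
    i < r -> e x y ->
    (forall j a, j < r -> j != i -> a \in A j -> e x a && e y a) -> False.
  by move=> h1 h2 h3 h4 h5; rewrite (contains_parts es ei h1 h2 h3 h4 h5) in free.
have cP i : i < r -> #|P i| = s by move=> ir; have [] := P_sub i ir.
pose tight v i := [forall a in P i, ~~ e v a] &&
  [forall j : 'I_r, (val j != i) ==> [forall a in P j, e v a]].
have class v : v \in U -> s <= \sum_(j < r) #|nonnbr e (P j) v| /\
    (\sum_(j < r) #|nonnbr e (P j) v| <= s -> exists2 i, i < r & tight v i).
  move=> vU; have [/existsP[i /forallP iv]|no_i] :=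
      boolP [exists i : 'I_r, [forall a in P i, ~~ e v a]].
    have nPi : #|nonnbr e (P i) v| = s.
      rewrite -(cP i) //; apply: eq_card => a; rewrite inE.
      by have := iv a; case: (a \in P i) => //= ->.
    rewrite (bigD1 i) //= nPi; split; first exact: leq_addr.
    rewrite -[leqRHS]addn0 leq_add2l leqn0 sum_nat_eq0 => /forallP zero.
    exists i => //; apply/andP; split; first by apply/forallP.
    apply/forallP => j; apply/implyP => ji; apply/forallP => a; apply/implyP => aj.
    have := zero j; rewrite -val_eqE ji cards_eq0 => /eqP /setP /(_ a).
    by rewrite !inE aj /= => /negbFE.
  have nbr (i : 'I_r) : exists2 y, y \in P i & e v y.
    have := existsPn no_i i; rewrite negb_forall => /existsP[y].
    by rewrite negb_imply negbK => /andP[yP vy]; exists y.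
  suff : s < \sum_(j < r) #|nonnbr e (P j) v| by move=> h; split; [exact: ltnW | rewrite leqNgt h].
  case: (@arg_maxnP _ (Ordinal r0) xpredT (fun j : 'I_r => #|nonnbr e (P j) v|) isT).
  move=> i _ i_max; have [y yP vy] := nbr i.
  have [j ji mj] : exists2 j : 'I_r, j != i & t < #|nonnbr e (P j) v|.
    have [/existsP[j /andP[ji mj]]|no_j] :=
        boolP [exists j : 'I_r, (j != i) && (t < #|nonnbr e (P j) v|)].
      by exists j.
    case: (freeP (fun j => if j == i then P i else [set a in P j | e v a]) i v y) => //.
    - move=> j k jr kr jk a a' aj ak; apply: (P_compl j k) => //.
        by move: aj; case: eqP => [->//|_]; rewrite inE => /andP[].
      by move: ak; case: eqP => [->//|_]; rewrite inE => /andP[].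
    - move=> j jr; case: (j =P i) => [_|/eqP ji]; first by rewrite cP // /s; lia.
      have := existsPn no_j (Ordinal jr); rewrite -val_eqE /= ji /= -leqNgt.
      have := card_setID_pred (P j) (e v); rewrite cP // -/(nonnbr e (P j) v) /s; lia.
    - move=> j a jr ji; rewrite (negPf ji) inE => /andP[aP ->] /=.
      by apply: (P_compl i j) => //; rewrite eq_sym.
  have := i_max j isT; rewrite (bigD1 i) //= (bigD1 j) //= /s; lia.
pose W i := [set v in U | tight v i].
have WU i v : v \in W i -> v \in U by rewrite inE => /andP[].
have W_indep i x y : i < r -> x \in W i -> y \in W i -> ~~ e x y.
  move=> ir xW yW; apply/negP => exy.
  apply: (freeP P i x y) => // [j jr|j a jr ji aj]; first by rewrite cP // /s; lia.
  move: xW yW; rewrite !inE => /and3P[_ _ /forallP/(_ (Ordinal jr)) xj].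
  move=> /and3P[_ _ /forallP/(_ (Ordinal jr)) yj].
  rewrite /= ji /= in xj yj.
  by rewrite (implyP (forallP xj a) aj) (implyP (forallP yj a) aj).
have W_le i : i < r -> #|W i| <= b.
  move=> ir; have [->|[v vW]] := set_0Vmem (W i); first by rewrite cards0.
  apply: leq_trans (nb v (WU i v vW)); apply/subset_leq_card/subsetP => y yW.
  by rewrite inE (WU i) //= (W_indep i).
have W_disj i j : i < r -> j < r -> i != j -> [disjoint W i & W j].
  move=> ir jr ij; rewrite -setI_eq0; apply/eqP/setP => v; rewrite !inE; apply/negP.
  case/andP=> /and3P[_ /forallP vi _] /and3P[_ _ /forallP/(_ (Ordinal ir))].
  rewrite /= ij /= => /forallP vi'.
  have : 0 < #|P i| by rewrite cP // /s; lia.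
  case/card_gt0P=> a aP; have := vi a; have := vi' a.
  by rewrite aP /= => ->.
have sumW : n.+1 <= \sum_(i < r) #|W i| + s * r.
  pose Z := [set v in U | s < \sum_(j < r) #|nonnbr e (P j) v|].
  have cZ : #|Z| <= s * r.
    have := sum_nonnbr_parts es nb P_sub; set S := \sum_(v in U) _ => S_le.
    have S_ge : s * n.+1 + #|Z| <= S.
      rewrite -cU mulnC -sum_nat_const -sum1_card /S.
      rewrite [X in _ + X](_ : _ = \sum_(v in U) (v \in Z)); last first.
        rewrite -big_mkcondr /=; apply: eq_bigl => v; rewrite inE andbA.
        by case: (v \in U).
      rewrite -big_split /=; apply: leq_sum => v vU; have [h _] := class v vU.
      by rewrite inE vU /=; case: ltnP => //=; rewrite ?addn1 ?addn0.
    have : r * s * b <= s * (n + r) by rewrite (mulnC r) -mulnA leq_mul2l rb orbT.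
    move: S_le S_ge; lia.
  rewrite -cU; apply: (@leq_trans #|\bigcup_(i < r) W i :|: Z|).
    apply/subset_leq_card/subsetP => v vU; rewrite !inE vU /=.
    case: ltnP => [_|h]; first by rewrite orbT.
    have [_ /(_ h) [i ir vi]] := class v vU; rewrite orbF.
    by apply/bigcupP; exists (Ordinal ir) => //; rewrite inE vU.
  apply: leq_trans (leq_card_setU _ _) _; apply: leq_add => //.
  exact: card_bigcup_le.
have W_ge i : i < r -> b <= #|W i| + C.
  move=> ir; move: sumW; rewrite (bigD1 (Ordinal ir)) //=.
  have : \sum_(j < r | j != Ordinal ir) #|W j| <= r.-1 * b.
    rewrite -[r in leqRHS]card_ord -(cardC1 (Ordinal ir)) -sum_nat_const.
    rewrite (eq_bigl (mem (predC1 (Ordinal ir)))) //.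
    by apply: leq_sum => j _; apply: W_le.
  have : b + r.-1 * b = r * b by rewrite -mulSn prednK.
  move: rb; rewrite /C; move: (r * b) (r.-1 * b) (s * r) (\sum_(j < r | _) _) #|W i| => R1 R2 R3 R4 w; lia.
have W_miss z i j : z \in U -> i < r -> j < r -> j != i ->
    (forall y, y \in W i -> ~~ e z y) -> #|nonnbr e (W j) z| <= C.
  move=> zU ir jr ji zi; have := W_ge i ir; have := nb z zU.
  have : #|W i| + #|nonnbr e (W j) z| <= #|nonnbr e U z|.
    rewrite -cardsUI (_ : W i :&: _ = set0) ?cards0 ?addn0.
      apply/subset_leq_card/subsetP => y; rewrite inE => /orP[yW|].
        by rewrite inE (WU i) ?zi.
      by rewrite inE => /andP[yW zy]; rewrite inE (WU j).
    apply/setP => y; rewrite in_setI in_set0; apply/negP => /andP[yi].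
    rewrite inE => /andP[yj _]; have := W_disj i j ir jr; rewrite eq_sym => /(_ ji).
    by rewrite disjoint_subset => /subsetP/(_ y yi); rewrite inE /= yj.
  lia.
have no_edge x y i : i < r -> e x y ->
    (forall j, j < r -> j != i -> G <= #|[set a in W j | e x a && e y a]|) -> False.
  move=> ir exy xyW.
  pose B j := if j == i then W i else [set a in W j | e x a && e y a].
  have BW j : B j \subset W j.
    rewrite /B; case: eqP => [->//|_]; apply/subsetP => a.
    by rewrite inE => /andP[].
  have [] := @greedy_parts T e es r t C B.
  - move=> j jr; rewrite -/G /B; case: (j =P i) => [_|/eqP ji]; last exact: xyW.
    have := W_ge i ir; lia.
  - move=> j k jr kr jk z zB; apply: (@leq_trans #|nonnbr e (W k) z|).
      apply/subset_leq_card/subsetP => a; rewrite !inE => /andP[/(subsetP (BW k))].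
      by rewrite inE => -> ->.
    have zW := subsetP (BW j) z zB.
    apply: (W_miss z j k) => //; [exact: WU zW | by rewrite eq_sym |].
    by move=> y' y'W; apply: (W_indep j).
  move=> A [A_compl A_sub]; apply: (freeP A i x y) => // [j jr|j a jr ji aj].
    by have [_ ->] := A_sub j jr.
  have [/subsetP/(_ a aj) + _] := A_sub j jr.
  by rewrite /B (negPf ji) inE => /andP[].
have missed z : z \in U -> [exists i : 'I_r, [forall y in W i, ~~ e z y]].
  move=> zU; apply: contraT => no_i.
  have nbr (i : 'I_r) : exists2 y, y \in W i & e z y.
    have := existsPn no_i i; rewrite negb_forall => /existsP[y].
    by rewrite negb_imply negbK => /andP[yW zy]; exists y.
  case: (@arg_maxnP _ (Ordinal r0) xpredT (fun j : 'I_r => #|nonnbr e (W j) z|) isT).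
  move=> i _ i_max; have [w wW zw] := nbr i.
  exfalso; apply: (no_edge z w i) => // j jr ji.
  have miss_w : #|nonnbr e (W j) w| <= C.
    apply: (W_miss w i j) => //; first exact: WU wW.
    by move=> y yW; apply: (W_indep i).
  have := i_max (Ordinal jr) isT; have := card_setI_pred2 (W j) (e z) (e w).
  rewrite -/(nonnbr e (W j) z) -/(nonnbr e (W j) w); have := W_ge j jr; have := nb z zU.
  have : #|nonnbr e (W i) z| + #|nonnbr e (W j) z| <= #|nonnbr e U z|.
    rewrite -cardsUI (_ : _ :&: _ = set0) ?cards0 ?addn0.
      apply/subset_leq_card/subsetP => y; rewrite inE => /orP[|].
        by rewrite inE => /andP[yW zy]; rewrite inE (WU i).
      by rewrite inE => /andP[yW zy]; rewrite inE (WU j).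
    apply/setP => y; rewrite in_setI in_set0; apply/negP => /andP[].
    rewrite inE => /andP[yi _]; rewrite inE => /andP[yj _].
    have := W_disj i j (ltn_ord i) jr; rewrite eq_sym => /(_ ji).
    by rewrite disjoint_subset => /subsetP/(_ y yi); rewrite inE /= yj.
  move=> /= h1 h2 h3 h4 h5; lia.
pose c z := odflt (Ordinal r0) [pick i : 'I_r | [forall y in W i, ~~ e z y]].
have cE z : z \in U -> forall y, y \in W (c z) -> ~~ e z y.
  move=> zU; rewrite /c; case: pickP => [i /forallP iz y yW|none].
    by have := iz y; rewrite yW.
  by have /existsP[i] := missed z zU; rewrite none.
exists c => x y xU yU exy; apply/eqP => cxy.
apply: (no_edge x y (c x)) => // j jr ji.
have mx := W_miss x (c x) j xU (ltn_ord _) jr ji (cE x xU).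
have my : #|nonnbr e (W j) y| <= C.
  by apply: (W_miss y (c x) j) => //; rewrite cxy; apply: cE.
have := card_setI_pred2 (W j) (e x) (e y); have := W_ge j jr.
rewrite -/(nonnbr e (W j) x) -/(nonnbr e (W j) y); lia.
Qed.

End Structure.

(** * Progressive induction *)

Lemma nmatch_le_exp (T : finType) (e : rel T) l (U : {set T}) : nmatch e l U <= #|U| ^ (2 * l).
Proof.
elim: l U => [//|l IH] U; rewrite nmatchS mulnS expnD.
apply: (@leq_trans (nmatch e 1 U * #|U| ^ (2 * l))); last first.
  by rewrite leq_mul2r nmatch1_le orbT.
rewrite nmatchS big_distrl /=; apply: leq_sum => p _; rewrite {2}/nmatch mul1n.
apply: leq_trans (IH _) _; have [->//|l0] := posnP l.
by rewrite leq_exp2r ?muln_gt0 ?l0 // subset_leq_card // (subset_trans (subsetDl _ _)) ?subsetDl.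
Qed.

Section ProgressiveInduction.
Variables (V : finType) (eF : rel V) (r : nat) (cF : V -> nat) (u0 v0 : V).
Hypothesis cF_crit : critical_coloring eF r cF u0 v0.

Definition eventually_free (P : forall T : finType, rel T -> {set T} -> Prop) : Prop :=
  exists n0, forall (T : finType) (e : rel T) (U : {set T}),
    symmetric e -> irreflexive e -> ~~ contains e eF -> n0 <= #|U| -> P T e U.

(* Removing a vertex of low degree strictly decreases the excess over the Turan
   graph, so for large [U] the excess has vanished. *)
Lemma free_nmatchS_le k :
  eventually_free (fun T e U => r ^ k * nmatch e k U <= mbound r k #|U|) ->
  eventually_free (fun T e U => nmatch e k.+1 U <= turan_count r k.+1 #|U|).
Proof.
case=> m0 upper; have [cF_r _ _ _] := cF_crit.
have r0 : 0 < r by apply: leq_ltn_trans (cF_r u0).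
have [n1 low_deg] := nmatch_low_degree k r0.
have [n2 partite] := partite_of_min_degree cF_crit r0.
pose N := n1 + n2 + m0.+1; pose M := N ^ (2 * k.+1).
exists (N + M) => T e U es ei free NU.
suff excess j (X : {set T}) : #|X| = N + j ->
    nmatch e k.+1 X <= turan_count r k.+1 #|X| + (M - j).
  have := excess (#|U| - N) U; lia.
elim: j X => [|j IH] X cX.
  by rewrite subn0; apply: leq_trans (nmatch_le_exp _ _ _) _; rewrite cX addn0 leq_addl.
have cX' : #|X| = (N + j).+1 by rewrite cX addnS.
have [/existsP[v /andP[vX dv]]|no_low] :=
    boolP [exists v, (v \in X) && (deg e X v < (N + j) - (N + j) %/ r)].
  have cXv : #|X :\ v| = N + j by have := cardsD1 v X; rewrite vX cX'; lia.
  have n1N : n1 <= N + j by rewrite /N; lia.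
  have lt_dec : nmatch e k.+1 X + turan_count r k.+1 (N + j) <
      nmatch e k.+1 (X :\ v) + turan_count r k.+1 (N + j).+1.
    apply: low_deg => // Y YX cY; apply: upper => //; rewrite /N in cY; lia.
  have := IH _ cXv; rewrite cX' cXv; lia.
have mind v : v \in X -> N + j - (N + j) %/ r <= deg e X v.
  by move=> vX; have := existsPn no_low v; rewrite vX /= -leqNgt.
have n2N : n2 <= N + j by rewrite /N; lia.
have [c c_proper] := partite T e X (N + j) es ei free n2N cX' mind.
by apply: leq_trans (nmatch_partite_le _ c_proper) _; apply: leq_addr.
Qed.

Lemma free_nmatch_le l :
  eventually_free (fun T e U => nmatch e l U <= turan_count r l #|U|).
Proof.
have [cF_r _ _ _] := cF_crit.
have r0 : 0 < r by apply: leq_ltn_trans (cF_r u0).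
case: l => [|k]; first by exists 0.
apply: free_nmatchS_le.
have [|m0 edges] := @free_nmatchS_le 0; first by exists 0.
exists (m0 + 2 * k) => T e U es ei free; apply: nmatch_le_mbound => // X mX.
apply: leq_trans (turan_count_edges_le _ r0); rewrite leq_mul2l; apply/orP; right.
exact: edges.
Qed.

End ProgressiveInduction.

(** * Copies and embeddings *)

Section Copies.
Variables (W : finType) (eH : rel W) (T : finType) (eG : rel T).
Hypotheses (eH_sym : symmetric eH) (eG_sym : symmetric eG).

Definition embeddings : {set {ffun W -> T}} :=
  [set f : {ffun W -> T} | injectiveb f && [forall x, forall y, eH x y ==> eG (f x) (f y)]].

Definition automorphisms : {set {ffun W -> W}} :=
  [set s : {ffun W -> W} | injectiveb s && [forall x, forall y, eH (s x) (s y) == eH x y]].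

Lemma card_automorphisms_gt0 : 0 < #|automorphisms|.
Proof.
apply/card_gt0P; exists [ffun x => x]; rewrite inE; apply/andP; split.
  by apply/injectiveP => x y; rewrite !ffunE.
by apply/forallP => x; apply/forallP => y; rewrite !ffunE.
Qed.

Lemma set2_eq (U : finType) (a b c d : U) :
  [set a; b] = [set c; d] -> (a = c /\ b = d) \/ (a = d /\ b = c).
Proof.
move=> E; have := set21 a b; have := set22 a b; rewrite E !inE.
have := set21 c d; have := set22 c d; rewrite -E !inE.
move=> /orP[]/eqP h1 /orP[]/eqP h2 /orP[]/eqP h3 /orP[]/eqP h4;
  by first [left; split; congruence | right; split; congruence].
Qed.

Let copies := [set p : {set T} * {set {set T}} |
      [&& p.2 \subset edge_set eG,
          [forall A in p.2, A \subset p.1] &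
          [exists f : {ffun W -> T},
             [&& injectiveb f, f @: setT == p.1 &
                 [forall x, forall y, eH x y == ([set f x; f y] \in p.2)]]]]].

Let image (f : {ffun W -> T}) : {set T} * {set {set T}} :=
  (f @: setT, [set [set f p.1; f p.2] | p in [set p : W * W | eH p.1 p.2]]).

Let mem_image (f : {ffun W -> T}) x y : injective f ->
  ([set f x; f y] \in (image f).2) = eH x y.
Proof.
move=> f_inj; apply/imsetP/idP => [[[x' y']]|xy]; last by exists (x, y); rewrite ?inE.
rewrite inE /= => xy' /set2_eq[[/f_inj-> /f_inj->//]|[/f_inj-> /f_inj->]].
by rewrite eH_sym.
Qed.

Let image_copies f : f \in embeddings -> image f \in copies.
Proof.
rewrite inE => /andP[/injectiveP f_inj /forallP f_hom]; rewrite inE; apply/and3P; split.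
- apply/subsetP => A /imsetP[[x y]]; rewrite inE /= => xy ->.
  by apply: imset2_f => //; rewrite inE (implyP (forallP (f_hom x) y)).
- apply/forallP => A; apply/implyP => /imsetP[[x y] _ ->]; apply/subsetP => z.
  by rewrite !inE => /orP[] /eqP->; apply: imset_f.
apply/existsP; exists f; apply/and3P; split=> //; first exact/injectiveP.
by apply/forallP => x; apply/forallP => y; rewrite mem_image.
Qed.

Let copies_image p : p \in copies -> exists2 f, f \in embeddings & image f = p.
Proof.
case: p => S E; rewrite inE /= => /and3P[/subsetP EG /forallP ES /existsP[f]].
case/and3P=> f_inj /eqP fS /forallP fE.
have fE' x y : eH x y = ([set f x; f y] \in E) by apply/eqP/(forallP (fE x)).
have Eedge u v : [set u; v] \in E -> eG u v.
  move/EG/imset2P=> [u' v' _]; rewrite inE => /andP[_ uv'].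
  by case/set2_eq=> -[-> ->] //; rewrite eG_sym.
exists f.
  rewrite inE f_inj; apply/forallP => x; apply/forallP => y; apply/implyP.
  by rewrite fE'; apply: Eedge.
rewrite /image fS; congr pair; apply/setP => A; apply/imsetP/idP.
  by case=> -[x y]; rewrite inE /= fE' => xyE ->.
move=> AE; have /imset2P[u v _ _ AE'] := EG A AE.
have := ES A; rewrite AE /= AE' subUset !sub1set -fS => /andP[/imsetP[x _ ux] /imsetP[y _ vy]].
by exists (x, y); rewrite ?inE /= ?fE' -?ux -?vy -?AE'.
Qed.

Lemma card_embeddings : #|embeddings| = ncopies eH eG * #|automorphisms|.
Proof.
rewrite -sum1_card (partition_big image (mem copies)) /=; last exact: image_copies.
rewrite /ncopies -/copies -sum_nat_const; apply: eq_bigr => p /copies_image[f0 f0E <-].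
move: (f0E); rewrite inE => /andP[/injectiveP f0_inj _].
have h_inj : injective (fun s : {ffun W -> W} => [ffun x => f0 (s x)]).
  move=> s s' /ffunP ss'; apply/ffunP => x; have := ss' x; rewrite !ffunE.
  exact: f0_inj.
rewrite -(card_imset _ h_inj) -sum1_card; apply: eq_bigl => f.
apply/andP/imsetP => [[]|[s]].
  rewrite inE => /andP[/injectiveP f_inj _] /eqP [fS fE].
  have pre x : exists y, f x == f0 y.
    have : f x \in f0 @: setT by rewrite -fS imset_f.
    by case/imsetP=> y _ ->; exists y.
  pose s := [ffun x => xchoose (pre x)].
  have sE x : f x = f0 (s x) by rewrite ffunE; apply/eqP/(xchooseP (pre x)).
  exists s; last by apply/ffunP => x; rewrite ffunE sE.
  rewrite inE; apply/andP; split.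
    by apply/injectiveP => x y /(congr1 f0); rewrite -!sE; apply: f_inj.
  apply/forallP => x; apply/forallP => y; rewrite -(mem_image (s x) (s y) f0_inj) -!sE.
  by rewrite -(mem_image x y f_inj) /image /= fE.
rewrite inE => /andP[/injectiveP s_inj /forallP s_aut] fE.
have fx x : f x = f0 (s x) by rewrite fE ffunE.
have sH x y : eH (s x) (s y) = eH x y by apply/eqP/(forallP (s_aut x)).
have s_surj x : exists y, s y = x by have [g _ gK] := injF_bij s_inj; exists (g x).
split.
  rewrite inE; apply/andP; split.
    by apply/injectiveP => x y; rewrite !fx => /f0_inj/s_inj.
  apply/forallP => x; apply/forallP => y; rewrite !fx -sH.
  by move: f0E; rewrite inE => /andP[_ /forallP/(_ (s x))/forallP/(_ (s y))].
apply/eqP; congr pair; apply/setP => z; apply/imsetP/imsetP.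
- by case=> x _ ->; exists (s x); rewrite ?fx.
- by case=> x _ ->; have [y <-] := s_surj x; exists y; rewrite ?fx.
- by case=> -[x y]; rewrite inE /= => xy ->; exists (s x, s y); rewrite ?inE /= ?sH ?fx.
case=> -[x y]; have [x' <-] := s_surj x; have [y' <-] := s_surj y.
by rewrite inE /= sH => xy ->; exists (x', y'); rewrite ?inE /= ?fx.
Qed.

End Copies.

Section Matchings.
Variables (T : finType) (e : rel T).
Hypotheses (e_sym : symmetric e) (e_irr : irreflexive e).

Fixpoint matching_seq (U : {set T}) (s : seq T) : bool :=
  match s with
  | [::] => true
  | [:: _] => false
  | [:: x, y & s'] => edge_in e U (x, y) && matching_seq (U :\ x :\ y) s'
  end.

Lemma card_matching_seq l (U : {set T}) :
  #|[set t : (l.*2).-tuple T | matching_seq U t]| = nmatch e l U.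
Proof.
elim: l U => [|l IH] U.
  rewrite (_ : [set t | _] = setT) ?cardsT ?card_tuple //.
  by apply/setP => t; rewrite !inE tuple0.
rewrite -sum1_card nmatchS.
pose h (q : (T * T) * (l.*2).-tuple T) : (l.+1).*2.-tuple T :=
  [tuple of [:: q.1.1, q.1.2 & q.2]].
pose g (t : (l.+1).*2.-tuple T) : (T * T) * (l.*2).-tuple T :=
  ((thead t, thead (behead_tuple t)), behead_tuple (behead_tuple t)).
have hK : cancel h g.
  move=> [[x y] t]; rewrite /g /h; congr ((_, _), _); rewrite ?theadE //.
  exact: val_inj.
have gK : cancel g h.
  move=> t; apply: val_inj => /=; case: (tupleP t) => x t1; case: (tupleP t1) => y t2.
  by rewrite /thead !(tnth_nth x).
rewrite (reindex h) /=; last by exists g => t _; [exact: hK | exact: gK].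
rewrite (eq_bigl (fun q : (T * T) * (l.*2).-tuple T => edge_in e U q.1 && matching_seq (U :\ q.1.1 :\ q.1.2) q.2)).
  rewrite -(pair_big_dep (edge_in e U)
    (fun p (t : (l.*2).-tuple T) => matching_seq (U :\ p.1 :\ p.2) t) (fun _ _ => 1)) /=.
  apply: eq_bigr => p _; rewrite -IH -sum1_card.
  by apply: eq_bigl => t; rewrite inE.
by move=> [[x y] t]; rewrite inE.
Qed.

Lemma matching_seqP l (U : {set T}) (s : seq T) : size s = l.*2 ->
  reflect [/\ uniq s, {subset s <= U} &
    forall x0 i, i < l -> e (nth x0 s i.*2) (nth x0 s i.*2.+1)] (matching_seq U s).
Proof.
elim: l U s => [|l IH] U [|x [|y s]] //= size_s; first by apply: ReflectT; split.
have {}size_s : size s = l.*2 by move: size_s; rewrite doubleS => -[].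
apply: (iffP andP) => [[/and3P[/= xU yU exy] /(IH _ _ size_s)[s_uniq sU s_e]]|].
  have sU' z : z \in s -> [/\ z != y, z != x & z \in U].
    by move/sU; rewrite !inE => /and3P[].
  have xy : x != y by apply: contraTneq exy => ->; rewrite e_irr.
  split.
  - rewrite s_uniq inE negb_or xy andbT /=; apply/andP; split; apply/negP => /sU'[].
      by rewrite eqxx.
    by rewrite eqxx.
  - by move=> z; rewrite !inE => /or3P[/eqP->|/eqP->|/sU'[]].
  by move=> x0 [|i] // il; apply: s_e.
case=> /and3P[]; rewrite inE negb_or => /andP[xy xs] ys s_uniq sU s_e; split.
  rewrite /edge_in /= !sU ?inE ?eqxx ?orbT //=.
  by have := s_e x 0 isT.
apply/(IH _ _ size_s); split=> // [z zs|x0 i il]; last exact: (s_e x0 i.+1).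
rewrite !inE sU ?inE ?zs ?orbT // andbT; apply/andP; split.
  by apply: contraNneq ys => <-.
by apply: contraNneq xs => <-.
Qed.

Lemma card_matching_embeddings l : #|embeddings (matching_rel l) e| = nmatch e l setT.
Proof.
rewrite -card_matching_seq.
pose h (f : {ffun 'I_(l.*2) -> T}) := mktuple f.
have h_inj : injective h.
  move=> f g fg; apply/ffunP => i.
  by have := congr1 (fun t : (l.*2).-tuple T => tnth t i) fg; rewrite /h !tnth_mktuple.
rewrite -(card_imset _ h_inj); apply: eq_card => t.
have tE : t = h [ffun i => tnth t i].
  by apply: eq_from_tnth => i; rewrite tnth_mktuple ffunE.
rewrite tE mem_imset // !inE; move: [ffun i => _] => {t tE} f.
have size_h : size (h f) = l.*2 by rewrite size_tuple.
have nthE x0 (i : 'I_(l.*2)) : nth x0 (h f) i = f i by rewrite -tnth_nth tnth_mktuple.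
apply/andP/(matching_seqP _ size_h) => [[f_inj /forallP f_hom]|[h_uniq _ h_e]].
  split=> [//|x _|x0 i il]; first by rewrite inE.
  have i1 : i.*2 < l.*2 by lia.
  have i2 : i.*2.+1 < l.*2 by lia.
  rewrite -[i.*2]/(val (Ordinal i1)) -[(val _).+1]/(val (Ordinal i2)) !nthE.
  apply: (implyP (forallP (f_hom _) _)); rewrite /matching_rel -val_eqE /=; lia.
split=> //; apply/forallP => x; apply/forallP => y; apply/implyP => /andP[xy /eqP half_xy].
have xl := ltn_ord x; have yl := ltn_ord y; rewrite -val_eqE /= in xy half_xy.
have i_l : x./2 < l by lia.
have := h_e (f x) x./2 i_l.
have [[x_e y_e]|[x_e y_e]] : (x./2.*2 = x /\ x./2.*2.+1 = y) \/ (x./2.*2 = y /\ x./2.*2.+1 = x).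
- by lia.
- by rewrite y_e x_e !nthE.
by rewrite y_e x_e !nthE e_sym.
Qed.

Lemma matching_sym l : symmetric (matching_rel l).
Proof. by move=> x y; rewrite /matching_rel eq_sym (eq_sym (val x)./2). Qed.

Lemma nmatch_ncopies l :
  nmatch e l setT = ncopies (matching_rel l) e * #|automorphisms (matching_rel l)|.
Proof. by rewrite -card_matching_embeddings card_embeddings //; apply: matching_sym. Qed.

End Matchings.

(** * Chromatic number *)

Lemma colorable_card (V : finType) (e : rel V) : irreflexive e -> colorable e #|V|.
Proof.
move=> ei; apply/existsP; exists [ffun x => enum_rank x].
apply/forallP => x; apply/forallP => y; apply/implyP => exy; rewrite !ffunE.
by apply: contraTneq exy => /enum_rank_inj->; rewrite ei.
Qed.

Lemma colorable_leq (V : finType) (e : rel V) k k' : k <= k' -> colorable e k -> colorable e k'.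
Proof.
move=> kk' /existsP[c /forallP c_col]; apply/existsP; exists [ffun x => widen_ord kk' (c x)].
apply/forallP => x; apply/forallP => y; apply/implyP => exy; rewrite !ffunE.
exact: (implyP (forallP (c_col x) y) exy).
Qed.

Lemma chi_colorable (V : finType) (e : rel V) : irreflexive e -> colorable e (chi e).
Proof.
move=> ei; rewrite /chi; apply: (big_ind (fun k => colorable e k)) => //.
  exact: colorable_card.
by move=> k k' ek ek'; rewrite /minn; case: ifP.
Qed.

Lemma chi_leq (V : finType) (e : rel V) k : irreflexive e -> colorable e k -> chi e <= k.
Proof.
move=> ei ek; have big_le (s : seq 'I_(#|V|.+1)) :
    \big[minn/#|V|]_(j <- s | colorable e j) (j : nat) <= #|V|.
  apply: (big_ind (fun m => m <= #|V|)) => // [j j' jV _|j _]; last by rewrite -ltnS.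
  exact: leq_trans (geq_minl _ _) jV.
have [kV|Vk] := leqP k #|V|; last exact: leq_trans (big_le _) (ltnW Vk).
rewrite /chi; have := mem_index_enum (Ordinal (kV : k < #|V|.+1)).
elim: (index_enum _) => // j s IH; rewrite inE big_cons => /orP[/eqP <-|/IH {}IH].
  by rewrite ek geq_minl.
by case: ifP => // _; apply: leq_trans (geq_minr _ _) IH.
Qed.

Lemma critical_coloring_exists (V : finType) (eF : rel V) :
  symmetric eF -> irreflexive eF -> has_color_critical_edge eF ->
  exists (c : V -> nat) (u v : V), critical_coloring eF (chi eF).-1 c u v.
Proof.
move=> Fs Fi [u [v [uv chi_lt]]]; set r := (chi eF).-1.
have ei : irreflexive (del_edge eF u v) by move=> x; rewrite /del_edge Fi.
have : colorable (del_edge eF u v) r.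
  by apply: colorable_leq (chi_colorable ei); rewrite /r; lia.
case/existsP=> c /forallP c_col; exists (fun w => val (c w)), u, v.
have c_del w w' : del_edge eF u v w w' -> c w != c w'.
  exact: (implyP (forallP (c_col w) w')).
have c_edge w w' : eF w w' -> [\/ c w != c w', w = u /\ w' = v | w = v /\ w' = u].
  move=> ww'; have := c_del w w'; rewrite /del_edge ww' /=.
  have [/orP[]/andP[/eqP-> /eqP->]|_] := boolP (_ || _).
  - by move=> _; apply: Or32.
  - by move=> _; apply: Or33.
  by move=> /(_ isT); apply: Or31.
split=> //; [by move=> w; apply: ltn_ord | by apply: contraTneq uv => ->; rewrite Fi |].
apply/eqP; rewrite val_eqE; apply: contraT => cuv.
suff : colorable eF r by move/(chi_leq Fi); rewrite /r; lia.
apply/existsP; exists c; apply/forallP => w; apply/forallP => w'; apply/implyP.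
by case/c_edge=> [//|[-> ->]//|[-> ->]]; rewrite eq_sym.
Qed.

Lemma turan_free (V : finType) (eF : rel V) n r : 0 < r -> irreflexive eF -> r < chi eF ->
  ~~ contains (turan_rel n r) eF.
Proof.
move=> r0 Fi; apply: contraL => /existsP[f /andP[_ /forallP f_hom]]; rewrite -leqNgt.
apply: chi_leq => //; apply/existsP.
exists [ffun x => Ordinal (ltn_pmod (f x) r0)]; apply/forallP => x; apply/forallP => y.
apply/implyP => xy; rewrite !ffunE -val_eqE /=.
exact: (implyP (forallP (f_hom x) y) xy).
Qed.

Theorem theorem3p8 (l : nat) (V : finType) (eF : rel V) :
  0 < l -> symmetric eF -> irreflexive eF ->
  has_color_critical_edge eF ->
  ~~ contains (matching_rel l) eF ->
  exists n0 : nat, forall n : nat, n0 <= n ->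
    ex_gen n (matching_rel l) eF = ncopies (matching_rel l) (turan_rel n (chi eF).-1).
Proof.
move=> _ Fs Fi crit _; have [c [u [v c_crit]]] := critical_coloring_exists Fs Fi crit.
set r := (chi eF).-1 in c_crit *; have [c_r _ _ _] := c_crit.
have r0 : 0 < r by apply: leq_ltn_trans (c_r u).
have [n0 main] := free_nmatch_le c_crit l.
have aut0 := card_automorphisms_gt0 (matching_rel l).
exists n0 => n n0n; apply/eqP; rewrite eqn_leq; apply/andP; split.
  apply/bigmax_leqP => E /andP[/andP[/forallP E_sym /forallP E_irr] free].
  have es : symmetric (rel_of_set E) by move=> x y; apply/eqP/(forallP (E_sym x)).
  have ei : irreflexive (rel_of_set E) by move=> x; apply/negbTE/E_irr.
  rewrite -(leq_pmul2r aut0) -!nmatch_ncopies //; last 2 first.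
  - exact: turan_sym.
  - exact: turan_irr.
  by have := main _ _ setT es ei free; rewrite cardsT card_ord; apply.
pose E := [set p : 'I_n * 'I_n | turan_rel n r p.1 p.2].
have EE x y : rel_of_set E x y = turan_rel n r x y by rewrite /rel_of_set inE.
have es : symmetric (rel_of_set E) by move=> x y; rewrite !EE turan_sym.
have ei : irreflexive (rel_of_set E) by move=> x; rewrite EE turan_irr.
apply: (@leq_trans (ncopies (matching_rel l) (rel_of_set E))).
  rewrite -(leq_pmul2r aut0) -!nmatch_ncopies //; try exact: turan_sym; try exact: turan_irr.
  by apply: nmatch_subrel => x y _ _; rewrite EE.
apply: (@leq_bigmax_cond _ _ (fun E => ncopies (matching_rel l) (rel_of_set E))).
rewrite /simple_set -andbA; apply/and3P; split.
- by apply/forallP => x; apply/forallP => y; apply/eqP/es.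
- by apply/forallP => x; apply/negbT/ei.
apply: contra (turan_free n r0 Fi _); last by move: r0; rewrite /r; lia.
case/existsP=> f /andP[f_inj /forallP f_hom]; apply/existsP; exists f; rewrite f_inj.
apply/forallP => x; apply/forallP => y; apply/implyP => xy; rewrite -EE.
exact: (implyP (forallP (f_hom x) y) xy).
Qed.
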